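(* Let $1\le n\le m$ and $r\ge1$ be integers, $\mathbb{K}$ a field, $\mathbf{X}$ a generic $n\times m$ matrix, $\mathbf{L}$ a ladder of $\mathbf{X}$ whose associated column index set $\mathcal{L}$ is nonempty, and $L=I_n(\mathbf{X}_{\mathbf{L}})\subset\mathbb{K}[\mathbf{L}]$ the ideal generated by the maximal minors of the ladder matrix. The set $\mathcal{G}_{\mathcal{L}\times[r]}$ of nontrivial Hibi relations associated with the distributive lattice $\mathcal{L}\times[r]$ is a Gröbner basis of the presentation ideal of the special fiber ring $\mathcal{F}\big(\bigoplus_{i=1}^r\operatorname{in}_\tau(L)\big)$ with respect to any compatible monomial order $\sigma$ on $\mathbb{K}[T_{\boldsymbol a,i}\mid(\boldsymbol a,i)\in\mathcal{L}\times[r]]$. In particular, the $\mathbb{K}$-algebra $\mathcal{F}\big(\bigoplus_{i=1}^r\operatorname{in}_\tau(L)\big)$ is a Hibi ring.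
   Context: $\mathcal{D}=\{\boldsymbol a\in\mathbb{Z}_{+}^n\mid a_1<\dots<a_n\le m\}$ with componentwise order (meet = componentwise min, join = componentwise max); $[r]=\{1,\dots,r\}$ is a chain. A ladder $\mathbf{L}$ is a set of entries of $\mathbf{X}$ such that whenever $x_{i,j},x_{i',j'}\in\mathbf{L}$ with $i\le i'$, $j\ge j'$, then $x_{u,v}\in\mathbf{L}$ for all $i\le u\le i'$, $j'\le v\le j$; it is described by integers $1=\ell_1\le\dots\le\ell_n\le m$, $1\le k_1\le\dots\le k_n=m$ with $x_{i,j}\in\mathbf{L}\iff\ell_i\le j\le k_i$. $\mathbf{X}_{\mathbf{L}}$ is $\mathbf{X}$ with entries outside $\mathbf{L}$ set to zero, $[\boldsymbol a]_{\mathbf{L}}$ its maximal minor with columns $\boldsymbol a$, and $\mathcal{L}=\{\boldsymbol a\in\mathcal{D}\mid[\boldsymbol a]_{\mathbf{L}}\ne0\}$, which is a sublattice of $\mathcal{D}$. $\tau$ is the lexicographic order on $\mathbb{K}[\mathbf{L}]$ with $x_{i,j}>x_{l,k}$ iff $i<l$, or $i=l$ and $j<k$. One has $\operatorname{in}_\tau(L)=(\mathbf{x}_{\boldsymbol a}\mid\boldsymbol a\in\mathcal{L})$ with $\mathbf{x}_{\boldsymbol a}=x_{1,a_1}\cdots x_{n,a_n}$. The special fiber ring is $\mathcal{F}(\bigoplus_{i=1}^r\operatorname{in}_\tau(L))\cong\mathbb{K}[\mathbf{x}_{\boldsymbol a}t_i\mid(\boldsymbol a,i)\in\mathcal{L}\times[r]]$,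 and its presentation ideal is the kernel of $\mathbb{K}[T_{\boldsymbol a,i}]\to\mathbb{K}[\mathbf{x}_{\boldsymbol a}t_i]$, $T_{\boldsymbol a,i}\mapsto\mathbf{x}_{\boldsymbol a}t_i$. For a finite distributive lattice $\mathscr{L}$: the Hibi relation of $a,b\in\mathscr{L}$ is $f_{a,b}=T_aT_b-T_{a\wedge b}T_{a\vee b}\in\mathbb{K}[T_c\mid c\in\mathscr{L}]$; $\mathcal{G}_{\mathscr{L}}$ is the set of $f_{a,b}$ with $a,b$ incomparable (nontrivial Hibi relations); the Hibi ring is $\mathbb{K}[\mathscr{L}]=\mathbb{K}[T_c\mid c\in\mathscr{L}]/(f_{a,b}\mid a,b\in\mathscr{L})$. A monomial order on $\mathbb{K}[T_c\mid c\in\mathscr{L}]$ is compatible if the initial monomial of $f_{a,b}$ is $T_aT_b$ for all incomparable $a,b$. *)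

(* Defs.v *)
From HB Require Import structures.
From mathcomp Require Import all_boot all_order all_fingroup all_algebra.
From mathcomp Require Import boolp.
From mathcomp Require Import mpoly.
Set Implicit Arguments.
Unset Strict Implicit.
Unset Printing Implicit Defensive.
Import Order.TTheory GRing.Theory.
Local Open Scope ring_scope.

(* A polynomial ring K[I] with variables indexed by a finite type I is
   {mpoly K[#|I|]}; the variable attached to v : I is 'X_(enum_rank v).        *)

Section IdealsAndSubrings.

Variable R : comNzRingType.

Definition ideal_gen (S : R -> Prop) (x : R) : Prop :=
  exists s : seq (R * R),
    (forall p, p \in s -> S p.2) /\ x = \sum_(p <- s) p.1 * p.2.

Inductive subring_gen (S : R -> Prop) : R -> Prop :=
| subring_gen1 : subring_gen S 1
| subring_gen_in x : S x -> subring_gen S x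
| subring_genB x y : subring_gen S x -> subring_gen S y -> subring_gen S (x - y)
| subring_genM x y : subring_gen S x -> subring_gen S y -> subring_gen S (x * y).

Lemma ideal_gen_idealr (S : R -> Prop) :
  ~ ideal_gen S 1 -> idealr_closed (fun x => `[< ideal_gen S x >]).
Proof.
move=> S1; split.
- by apply/asboolP; exists [::]; rewrite big_nil.
- by apply/negP => /asboolP.
- move=> a x y /asboolP[s [sS ->]] /asboolP[t [tS ->]]; apply/asboolP.
  exists ([seq (a * p.1, p.2) | p <- s] ++ t); split.
    by move=> p; rewrite mem_cat => /orP[/mapP[q /sS qs ->]|/tS].
  rewrite big_cat big_map /= mulr_sumr; congr (_ + _).
  by apply: eq_bigr => p _; rewrite mulrA.
Qed.

Lemma ideal_gen_in (S : R -> Prop) x : S x -> ideal_gen S x.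
Proof.
by move=> Sx; exists [:: (1, x)]; split=> [p|];
  rewrite ?big_seq1 ?mul1r // mem_seq1 => /eqP ->.
Qed.

Lemma ideal_gen_rmorph0 (A : nzRingType) (f : {rmorphism R -> A})
    (S : R -> Prop) :
  (forall x, S x -> f x = 0) -> forall x, ideal_gen S x -> f x = 0.
Proof.
move=> fS x [s [sS ->]]; rewrite rmorph_sum big_seq big1 // => p /sS/fS fp0.
by rewrite rmorphM fp0 mulr0.
Qed.

End IdealsAndSubrings.

(* A commutative K-algebra is a ring A together with its structure map K -> A. *)
Definition algebra_iso (K A B : nzRingType) (iA : K -> A) (iB : K -> B) : Prop :=
  exists f : {rmorphism A -> B}, bijective f /\ forall c, f (iA c) = iB c.

Section Groebner.

Variables (K : fieldType) (N : nat).
Implicit Types (le : rel 'X_{1..N}) (S : {mpoly K[N]} -> Prop).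

Definition monomial_order le : Prop :=
  [/\ reflexive le, antisymmetric le, transitive le, total le &
      (forall u, le 0%MM u) /\
      (forall u v w, le u v -> le (u + w)%MM (v + w)%MM)].

(* This implies that f is nonzero. *)
Definition initial_monomial le (f : {mpoly K[N]}) (u : 'X_{1..N}) : Prop :=
  u \in msupp f /\ forall v, v \in msupp f -> le v u.

Definition initial_ideal le S : {mpoly K[N]} -> Prop :=
  ideal_gen (fun g =>
    exists f u, [/\ S f, initial_monomial le f u & g = 'X_[u]]).

Definition groebner_basis le (G I : {mpoly K[N]} -> Prop) : Prop :=
  (forall g, G g -> I g) /\
  (forall f, initial_ideal le I f <-> initial_ideal le G f).

End Groebner.

Section Hibi.

Variables (K : fieldType) (d : Order.disp_t) (P : finDistrLatticeType d).

Definition hibi_rel (a b : P) : {mpoly K[#|P|]} :=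
  'X_(enum_rank a) * 'X_(enum_rank b) -
  'X_(enum_rank (a `&` b)%O) * 'X_(enum_rank (a `|` b)%O).

Definition nontrivial_hibi (f : {mpoly K[#|P|]}) : Prop :=
  exists a b : P, (a >< b)%O /\ f = hibi_rel a b.

Definition hibi_compatible (le : rel 'X_{1..#|P|}) : Prop :=
  forall a b : P, (a >< b)%O ->
    initial_monomial le (hibi_rel a b) (U_(enum_rank a) + U_(enum_rank b))%MM.

Definition hibi_ideal : {pred {mpoly K[#|P|]}} :=
  fun f => `[< ideal_gen (fun g => exists a b : P, g = hibi_rel a b) f >].

Lemma hibi_ideal_idealr : idealr_closed hibi_ideal.
Proof.
apply: ideal_gen_idealr => /(ideal_gen_rmorph0 (f := mcoeff 0%MM)) H.
have/eqP : 1%:MP_[#|P|]@_0%MM = 0 :> K.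
  apply: H => _ [a [b ->]].
  by rewrite rmorphB !rmorphM /= !mcoeffX -!mdeg_eq0 !mdeg1 !mulr0 subr0.
by rewrite mcoeffC eqxx mulr1 oner_eq0.
Qed.

HB.instance Definition _ :=
  isIdealr.Build {mpoly K[#|P|]} hibi_ideal hibi_ideal_idealr.

Definition hibi_ring := {ideal_quot hibi_ideal}.

Definition hibi_scalar (c : K) : hibi_ring := (\pi_hibi_ring c%:MP)%qT.

End Hibi.

Definition is_hibi_ring (K : fieldType) (A : nzRingType) (iA : K -> A) : Prop :=
  exists (d : Order.disp_t) (P : finDistrLatticeType d),
    (0 < #|P|)%N /\ algebra_iso iA (@hibi_scalar K d P).

(* For ideals I_1, ..., I_r of R = K[x_1, ..., x_N], the Rees algebra of the
   module I_1 (+) ... (+) I_r is R[I_1 t_1, ..., I_r t_r], a subring of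
   R[t_1, ..., t_r]; the special fiber ring is its quotient by the extension of
   the maximal ideal (x_1, ..., x_N) of R.                                     *)
Section SpecialFiber.

Variables (K : fieldType) (N r : nat) (I : 'I_r -> {mpoly K[N]} -> Prop).

Definition rees_pred : {pred {mpoly {mpoly K[N]}[r]}} :=
  fun p => `[< subring_gen (fun y => (exists c, y = c%:MP) \/
                 (exists i f, I i f /\ y = f%:MP * 'X_i)) p >].

Lemma rees_pred_subring : subring_closed rees_pred.
Proof.
split=> [|x y /asboolP px /asboolP py|x y /asboolP px /asboolP py];
  apply/asboolP.
- exact: subring_gen1.
- exact: subring_genB.
- exact: subring_genM.
Qed.

HB.instance Definition _ :=
  GRing.isSubringClosed.Build _ rees_pred rees_pred_subring.

Record rees_algebra :=
  Rees { rees_val :> {mpoly {mpoly K[N]}[r]}; _ : rees_val \in rees_pred }.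

HB.instance Definition _ := [isSub for rees_val].
HB.instance Definition _ := [Choice of rees_algebra by <:].
HB.instance Definition _ := [SubChoice_isSubComNzRing of rees_algebra by <:].

Lemma rees_const_subproof (c : {mpoly K[N]}) : c%:MP \in rees_pred.
Proof. by apply/asboolP/subring_gen_in; left; exists c. Qed.

Definition rees_const (c : {mpoly K[N]}) : rees_algebra :=
  Rees (rees_const_subproof c).

Lemma rees_elt_subproof i f : I i f -> f%:MP * 'X_i \in rees_pred.
Proof. by move=> If; apply/asboolP/subring_gen_in; right; exists i, f. Qed.

Definition rees_elt i f (If : I i f) : rees_algebra :=
  Rees (rees_elt_subproof If).

Definition fiber_ideal : {pred rees_algebra} :=
  fun y => `[< ideal_gen (fun z => exists v, z = rees_const 'X_v) y >].

Lemma fiber_ideal_idealr : idealr_closed fiber_ideal.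
Proof.
pose f : {rmorphism rees_algebra -> K} := mcoeff 0%MM \o (mcoeff 0%MM \o val).
apply: ideal_gen_idealr => /(ideal_gen_rmorph0 (f := f)) H.
have /eqP : f 1 = 0.
  apply: H => _ [v ->].
  by rewrite /f /= mcoeffC eqxx mulr1 mcoeffX -mdeg_eq0 mdeg1.
by rewrite rmorph1 oner_eq0.
Qed.

HB.instance Definition _ :=
  isIdealr.Build rees_algebra fiber_ideal fiber_ideal_idealr.

Definition special_fiber := {ideal_quot fiber_ideal}.

Definition fiber_class (y : rees_algebra) : special_fiber :=
  (\pi_special_fiber y)%qT.

Definition fiber_scalar (c : K) : special_fiber :=
  fiber_class (rees_const c%:MP).

End SpecialFiber.

Definition is_ladder n m (L : {set 'I_n * 'I_m}) : Prop :=
  forall (i i' : 'I_n) (j j' : 'I_m),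
    (i, j) \in L -> (i', j') \in L -> (i <= i')%N -> (j' <= j)%N ->
    forall (u : 'I_n) (v : 'I_m),
      (i <= u <= i')%N -> (j' <= v <= j)%N -> (u, v) \in L.

(* No normalization (such as every column meeting L) is imposed. *)
Record ladder n m :=
  Ladder { ladder_set :> {set 'I_n * 'I_m}; ladderP : is_ladder ladder_set }.

Section LadderMinors.

Variables (n m : nat) (K : fieldType) (L : ladder n m).

Definition ladder_entry := {e : 'I_n * 'I_m | e \in (L : {set _})}.

Local Notation N := #|{: ladder_entry}|.

Definition ladder_mx : 'M[{mpoly K[N]}]_(n, m) :=
  \matrix_(i, j) oapp (fun v : ladder_entry => 'X_(enum_rank v)) 0
                      (insub (i, j)).

Definition maximal_minor (a : n.-tuple 'I_m) : {mpoly K[N]} :=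
  \det (colsub (tnth a) ladder_mx).

Definition diagonal_term (a : n.-tuple 'I_m) : {mpoly K[N]} :=
  \prod_i ladder_mx i (tnth a i).

Definition increasing (a : n.-tuple 'I_m) : bool :=
  [forall i : 'I_n, forall j : 'I_n, (i < j)%N ==> (tnth a i < tnth a j)%N].

Definition minors_ideal : {mpoly K[N]} -> Prop :=
  ideal_gen (fun f => exists a, increasing a /\ f = maximal_minor a).

Definition ladder_var_gt (v w : 'I_N) : bool :=
  let: (i, j) := val (enum_val v) in let: (l, k) := val (enum_val w) in
  (i < l)%N || (i == l) && (j < k)%N.

Definition ladder_lex : rel 'X_{1..N} :=
  fun u1 u2 => (u1 == u2) ||
    [exists v, (u1 v < u2 v)%N &&
               [forall w, ladder_var_gt w v ==> (u1 w == u2 w)]].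

Definition initial_minors_ideal : {mpoly K[N]} -> Prop :=
  initial_ideal ladder_lex minors_ideal.

Definition ladder_cols_pred : {pred n.-tupleprod 'I_m} :=
  fun a => increasing a && (maximal_minor a != 0).

Let mon_at (e : 'I_n * 'I_m) : 'X_{1..N} :=
  oapp (fun v : ladder_entry => U_(enum_rank v)%MM) 0%MM (insub e).

Let perm_mon (a : n.-tuple 'I_m) (s : 'S_n) : 'X_{1..N} :=
  (\big[+%MM/0%MM]_i mon_at (i, tnth a (s i)))%MM.

Let perm_ok (a : n.-tuple 'I_m) (s : 'S_n) :=
  [forall i, (i, tnth a (s i)) \in (L : {set _})].

Let insub_entry (e : 'I_n * 'I_m) (eL : e \in (L : {set _})) :
  insub e = Some (exist _ e eL : ladder_entry).
Proof. by case: insubP => [u _ ue|/negP//]; congr Some; apply: val_inj. Qed.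

Let perm_termE (a : n.-tuple 'I_m) (s : 'S_n) :
  \prod_i ladder_mx i (tnth a (s i)) =
  if perm_ok a s then 'X_[perm_mon a s] else 0.
Proof.
case: ifPn => [/forallP ok|/forallPn[i nok]]; last first.
  by rewrite (bigD1 i) //= mxE insubN // mul0r.
rewrite -mprodXE; apply: eq_bigr => i _.
by rewrite mxE /mon_at (insub_entry (ok i)).
Qed.

Let perm_monE (a : n.-tuple 'I_m) (s : 'S_n) (v : ladder_entry) : perm_ok a s ->
  perm_mon a s (enum_rank v) = (tnth a (s (val v).1) == (val v).2).
Proof.
move=> /forallP ok; rewrite /perm_mon mnm_sumE (bigD1 (val v).1) //= big1.
  rewrite addn0 /mon_at (insub_entry (ok _)) /= mnm1E (inj_eq enum_rank_inj).
  by rewrite -val_eqE /= [val v]surjective_pairing xpair_eqE eqxx.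
move=> i iv; rewrite /mon_at (insub_entry (ok _)) /= mnm1E (inj_eq enum_rank_inj).
by rewrite -val_eqE /= [val v]surjective_pairing xpair_eqE (negPf iv).
Qed.

Let minorE a : maximal_minor a =
  \sum_(s : 'S_n) (-1) ^+ s * (if perm_ok a s then 'X_[perm_mon a s] else 0).
Proof.
apply: eq_bigr => s _; rewrite -perm_termE; congr (_ * _).
by apply: eq_bigr => i _; rewrite !mxE.
Qed.

Let increasing_inj a : increasing a -> injective (tnth a).
Proof.
move=> /forallP inc i j aij; apply/val_inj; case: (ltngtP i j) => // ltij.
  by move: (inc i) => /forallP/(_ j)/implyP/(_ ltij); rewrite aij ltnn.
by move: (inc j) => /forallP/(_ i)/implyP/(_ ltij); rewrite aij ltnn.
Qed.

Let increasing_le a (i j : 'I_n) : increasing a -> (i <= j)%N ->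
  (tnth a i <= tnth a j)%N.
Proof.
move=> /forallP inc; rewrite leq_eqVlt => /orP[/eqP/val_inj-> //|ltij].
by move: (inc i) => /forallP/(_ j)/implyP/(_ ltij)/ltnW.
Qed.

Let perm_mon_inj (a : n.-tuple 'I_m) (s t : 'S_n) :
  increasing a -> perm_ok a s -> perm_ok a t ->
  perm_mon a s = perm_mon a t -> s = t.
Proof.
move=> inc oks okt e; apply/permP => i.
have /forallP/(_ i) si := oks; pose v : ladder_entry :=
  exist (fun e => e \in (L : {set _})) _ si.
move: (congr1 (fun u : 'X_{1..N} => u (enum_rank v)) e).
rewrite !perm_monE //= eqxx; case: eqP => // /(increasing_inj inc)/esym //.
Qed.

(* Any permutation s has, for every i, some i1 <= i <= i2 with s i1 >= i and
   s i2 <= i, so a nonzero term of a ladder minor forces the diagonal one.   *)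
Let perm_ge (s : 'S_n) (i : 'I_n) : exists2 k : 'I_n, (k <= i)%N & (i <= s k)%N.
Proof.
apply: contrapT => no.
have H (k : 'I_n) : (k <= i)%N -> (s k < i)%N.
  by move=> ki; rewrite ltnNge; apply/negP => ik; apply: no; exists k.
pose A := [set k : 'I_n | (k <= i)%N]; pose B := [set k : 'I_n | (k < i)%N].
have: (#|s @: A| <= #|B|)%N.
  apply: subset_leq_card; apply/subsetP => _ /imsetP[k kA ->].
  by move: kA; rewrite !inE => /H.
rewrite card_imset; last exact: perm_inj.
have -> : A = i |: B.
  by apply/setP => k; rewrite !inE leq_eqVlt.
by rewrite cardsU1 !inE ltnn add1n ltnn.
Qed.

Let perm_le (s : 'S_n) (i : 'I_n) : exists2 k : 'I_n, (i <= k)%N & (s k <= i)%N.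
Proof.
have [k ki ik] := perm_ge (s^-1)%g i.
by exists ((s^-1)%g k); rewrite ?permKV.
Qed.

Let perm_ok_diag (a : n.-tuple 'I_m) (s : 'S_n) :
  increasing a -> perm_ok a s -> perm_ok a 1.
Proof.
move=> inc /forallP ok; apply/forallP => i; rewrite perm1.
have [k1 k1i ik1] := perm_ge s i; have [k2 ik2 k2i] := perm_le s i.
apply: (ladderP (ok k1) (ok k2)); rewrite ?k1i ?ik2 ?(leq_trans k1i ik2) //.
  by apply: increasing_le => //; apply: leq_trans ik1.
by rewrite !increasing_le.
Qed.

Let mcoeff_sign (b : bool) (p : {mpoly K[N]}) u :
  ((-1) ^+ b * p)@_u = (-1) ^+ b * p@_u.
Proof. by case: b; rewrite ?expr0 ?expr1 ?mul1r ?mulN1r ?mcoeffN. Qed.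

Let minor_coef a : increasing a -> perm_ok a 1 ->
  (maximal_minor a)@_(perm_mon a 1) = 1.
Proof.
move=> inc ok1; rewrite minorE raddf_sum (bigD1 1%g) //= mcoeff_sign ok1.
rewrite odd_perm1 expr0 mul1r mcoeffX eqxx big1 ?addr0 // => s s1.
rewrite mcoeff_sign; case: ifP => oks; last by rewrite mcoeff0 mulr0.
rewrite mcoeffX; case: eqP => [|_]; last by rewrite mulr0.
by move=> /(perm_mon_inj inc oks ok1) e; rewrite e eqxx in s1.
Qed.

Let minor_supp a u : u \in msupp (maximal_minor a) ->
  exists2 s, perm_ok a s & u = perm_mon a s.
Proof.
rewrite mcoeff_msupp minorE raddf_sum => H; apply: contrapT => nos.
case/eqP: H; apply: big1 => s _ /=; rewrite mcoeff_sign.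
case: ifP => oks; last by rewrite mcoeff0 mulr0.
rewrite mcoeffX; case: eqP => [e|_]; last by rewrite mulr0.
by case: nos; exists s.
Qed.

Let minor_neq0_ok a : increasing a -> (maximal_minor a != 0) = perm_ok a 1.
Proof.
move=> inc; apply/idP/idP => [nz|ok].
  case e : (msupp (maximal_minor a)) => [|u r].
    by move/eqP: e; rewrite msupp_eq0 (negPf nz).
  have [|s oks _] := @minor_supp a u; first by rewrite e mem_head.
  exact: perm_ok_diag oks.
by apply: contraNneq (oner_neq0 K) => e; rewrite -(minor_coef inc ok) e mcoeff0.
Qed.

Lemma minor_neq0 a : increasing a ->
  (maximal_minor a != 0) = [forall i, (i, tnth a i) \in (L : {set _})].
Proof.
by move=> /minor_neq0_ok->; apply: eq_forallb => i; rewrite perm1.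
Qed.

Let perm_mon_lex (a : n.-tuple 'I_m) (s : 'S_n) :
  increasing a -> perm_ok a s -> perm_ok a 1 ->
  ladder_lex (perm_mon a s) (perm_mon a 1).
Proof.
move=> inc oks ok1; apply/orP.
have [->|s1] := eqVneq s 1%g; [by left|right].
have [i0 si0] : exists i, s i != i.
  apply: contrapT => no; case/eqP: s1; apply/permP => i; rewrite perm1.
  by apply/eqP/negPn/negP => si; apply: no; exists i.
have [i si imin] := @arg_minnP _ i0 (fun i => s i != i) (@nat_of_ord n) si0.
have fixlt (k : 'I_n) : (k < i)%N -> s k = k.
  by move=> ki; apply/eqP; apply: contraTT ki => /imin; rewrite -leqNgt.
have lt_isi : (i < s i)%N.
  rewrite ltn_neqAle eq_sym (inj_eq val_inj) si leqNgt; apply/negP => /fixlt.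
  by move=> /perm_inj e; rewrite e eqxx in si.
have /forallP/(_ i) := ok1; rewrite perm1 => vL.
pose v : ladder_entry :=
  exist (fun e => e \in (L : {set _})) _ vL.
apply/existsP; exists (enum_rank v); rewrite !perm_monE //= perm1 eqxx.
rewrite (inj_eq (increasing_inj inc)) (negPf si) /=.
apply/forallP => w; apply/implyP; rewrite -[w]enum_valK; set e := enum_val w.
rewrite /ladder_var_gt !enum_rankK !perm_monE //=.
rewrite [val e]surjective_pairing /= perm1.
case/orP => [/fixlt-> //|/andP[/eqP-> lt]].
have lt' : ((val e).2 < tnth a (s i))%N.
  by apply: leq_trans lt _; apply: increasing_le => //; apply: ltnW.
have neq (x : 'I_m) : ((val e).2 < x)%N -> (x == (val e).2) = false.
  by move=> ltx; apply/eqP => ex; rewrite ex ltnn in ltx.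
by rewrite !neq.
Qed.

Lemma diagonal_term_initial a : ladder_cols_pred a ->
  initial_minors_ideal (diagonal_term a).
Proof.
case/andP => inc nz; have ok1 := nz; rewrite minor_neq0_ok // in ok1.
have -> : diagonal_term a = 'X_[perm_mon a 1].
  transitivity (\prod_i ladder_mx i (tnth a ((1%g : 'S_n) i))).
    by apply: eq_bigr => i _; rewrite perm1.
  by rewrite perm_termE ok1.
apply: ideal_gen_in; exists (maximal_minor a), (perm_mon a 1); split=> //.
  by apply: ideal_gen_in; exists a.
split; first by rewrite mcoeff_msupp minor_coef // oner_eq0.
by move=> u /minor_supp[s oks ->]; apply: perm_mon_lex.
Qed.

Lemma ladder_cols_pred_lattice :
  {in ladder_cols_pred &, forall a b, (a `&` b)%O \in ladder_cols_pred} /\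
  {in ladder_cols_pred &, forall a b, (a `|` b)%O \in ladder_cols_pred}.
Proof.
suff gen (op : 'I_m -> 'I_m -> 'I_m) (a b c : n.-tuple 'I_m) :
    (forall x y, op x y = if (x < y)%N then x else y) \/
    (forall x y, op x y = if (x < y)%N then y else x) ->
    (forall i, tnth c i = op (tnth a i) (tnth b i)) ->
    ladder_cols_pred a -> ladder_cols_pred b -> ladder_cols_pred c.
  split=> a b aP bP.
    apply: (gen Order.min a b); [by left| |by []|by []] => i.
    by rewrite Order.TupleProdOrder.tnth_meet meetEtotal.
  apply: (gen Order.max a b); [by right| |by []|by []] => i.
  by rewrite Order.TupleProdOrder.tnth_join joinEtotal.
move=> opE cE /andP[inca +] /andP[incb +]; rewrite !minor_neq0 //.
move=> /forallP aL /forallP bL.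
have incc : increasing c.
  apply/forallP => i; apply/forallP => j; apply/implyP => ij; rewrite !cE.
  have aij : (tnth a i < tnth a j)%N.
    by move/forallP/(_ i)/forallP/(_ j)/implyP/(_ ij): inca.
  have bij : (tnth b i < tnth b j)%N.
    by move/forallP/(_ i)/forallP/(_ j)/implyP/(_ ij): incb.
  case: opE => opE; rewrite !opE;
    case: (ltnP (tnth a i) (tnth b i)) => h;
    case: (ltnP (tnth a j) (tnth b j)) => h' //.
  - exact: ltn_trans h bij.
  - exact: leq_ltn_trans h aij.
  - exact: leq_trans bij h'.
  - exact: ltn_trans aij h'.
rewrite /ladder_cols_pred incc minor_neq0 //; apply/forallP => i; rewrite cE.
by case: opE => ->; case: ifP.
Qed.

HB.instance Definition _ :=
  Order.isLatticeClosed.Build _ (n.-tupleprod 'I_m) ladder_cols_pred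
    ladder_cols_pred_lattice.1 ladder_cols_pred_lattice.2.

Record ladder_cols := LadderCols {
  ladder_cols_val : n.-tupleprod 'I_m; _ : ladder_cols_val \in ladder_cols_pred
}.

HB.instance Definition _ := [isSub for ladder_cols_val].
HB.instance Definition _ := [Finite of ladder_cols by <:].
HB.instance Definition _ := [SubChoice_isSubLattice of ladder_cols by <:
    with Order.seqprod_display ord_display].

Coercion ladder_cols_tuple (a : ladder_cols) : n.-tuple 'I_m :=
  ladder_cols_val a.

Lemma ladder_cols_meetUl :
  @left_distributive ladder_cols _ Order.meet Order.join.
Proof.
by move=> a b c; apply: val_inj; apply: meetUl.
Qed.

HB.instance Definition _ :=
  Order.Lattice_Meet_isDistrLattice.Build _ ladder_cols ladder_cols_meetUl.

Lemma diagonal_term_cols (a : ladder_cols) :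
  initial_minors_ideal (diagonal_term a).
Proof. by apply: diagonal_term_initial; case: a. Qed.

End LadderMinors.

Section InitialFiber.

Variables (n m r : nat) (K : fieldType) (L : ladder n m).

Definition initial_family (_ : 'I_r) := @initial_minors_ideal n m K L.

Definition initial_fiber := special_fiber initial_family.

Definition initial_fiber_scalar : K -> initial_fiber :=
  @fiber_scalar K _ r initial_family.

Definition ladder_index : finDistrLatticeType _ :=
  (ladder_cols K L *p 'I_r)%type.

Definition fiber_gen (p : ladder_index) : initial_fiber :=
  fiber_class (@rees_elt K _ r initial_family p.2 _ (diagonal_term_cols p.1)).

Definition presentation_ideal (f : {mpoly K[#|ladder_index|]}) : Prop :=
  mmap initial_fiber_scalar (fun k => fiber_gen (enum_val k)) f = 0.

End InitialFiber.

Arguments hibi_compatible K {d} P le.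
Arguments nontrivial_hibi K {d} P f.
Arguments initial_fiber_scalar {n m} r K L c.
Arguments presentation_ideal {n m} r K L f.
Arguments ladder_index {n m} r K L.

(* Main.v *)
(* The maximal minors of X_L form a Groebner basis: by Cramer's rule, two minors
   whose column sets differ in one position i satisfy
     x_{i,v} [a] - x_{i,a_i} [a'] = a combination with smaller leading terms,
   and any two a, a' with x_a, x_a' dividing a given monomial are linked through
   their meet by such moves, so all S-pairs reduce to zero. Hence in(L) is
   generated by the x_a, and the special fiber ring is generated by the classes
   of the x_a t_i.
   Every element of the Rees algebra has x-degree at least n times its t-degree,
   strictly so modulo the irrelevant ideal, while monomials in the x_a t_i have
   equality; so the presentation ideal is the kernel of the toric map
   T_{a,i} |-> x_a t_i.
   Replacing T_p T_q by T_{p /\ q} T_{p \/ q} preserves the toric image and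
   decreases the monomial in any compatible order. It terminates in a monomial
   supported on a chain, which is determined by its image, because the largest
   element of a chain is read off from the largest column in each row. So chain
   monomials are the minimal ones in the fibers of the toric map. *)
Require Import Defs.
From HB Require Import structures.
From mathcomp Require Import all_boot all_order all_fingroup all_algebra.
From mathcomp Require Import boolp.
From mathcomp Require Import mpoly.
Set Implicit Arguments.
Unset Strict Implicit.
Unset Printing Implicit Defensive.
Import Order.TTheory GRing.Theory.
Local Open Scope ring_scope.

(** * The lexicographic order on ladder monomials *)

Section LadderLex.

Variables (n m : nat) (L : ladder n m).
Local Notation N := #|{: ladder_entry L}|.
Implicit Types (u w : 'X_{1..N}) (e : 'I_n * 'I_m).

(** Row-by-row numbering of the entries. It turns the order on variables into that of natural
    numbers, so a first differing position is found by minimization. *)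
Let key (v : 'I_N) : nat :=
  ((val (enum_val v)).1 * m + (val (enum_val v)).2)%N.

Let ladder_var_gtE (v w : 'I_N) : ladder_var_gt v w = (key v < key w)%N.
Proof.
rewrite /ladder_var_gt /key; case: (val _) => i j; case: (val _) => l k /=.
have jm := ltn_ord j; have km := ltn_ord k.
case: (ltngtP i l) => [il|li|/val_inj->] /=.
- apply/esym; apply: leq_trans (leq_addr _ _); apply: leq_trans (leq_mul il (leqnn m)).
  by rewrite mulSn addnC ltn_add2r.
- have -> : (i == l) = false by apply/eqP => e; rewrite e ltnn in li.
  apply/esym/negbTE; rewrite -leqNgt; apply: leq_trans (leq_addr _ _).
  by apply: leq_trans (leq_mul li (leqnn m)); rewrite mulSn addnC leq_add2r ltnW.
- by rewrite eqxx ltn_add2l.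
Qed.

Let key_inj : injective key.
Proof.
move=> v w; rewrite /key => e; apply: enum_val_inj; apply: val_inj.
move: e; case: (val _) => i j; case: (val _) => l k /= e.
have jm := ltn_ord j; have km := ltn_ord k.
have m0 : (0 < m)%N by apply: leq_ltn_trans jm.
have: ((i * m + j) %/ m)%N = ((l * m + k) %/ m)%N by rewrite e.
have: ((i * m + j) %% m)%N = ((l * m + k) %% m)%N by rewrite e.
rewrite !modnMDl !divnMDl // !modn_small // !divn_small // !addn0.
by move=> /val_inj-> /val_inj->.
Qed.

Let lexP u w : reflect
  (u = w \/ exists v, (u v < w v)%N /\ forall x, (key x < key v)%N -> u x = w x)
  (ladder_lex u w).
Proof.
apply: (iffP orP) => [[/eqP|/existsP[v /andP[lt /forallP eq]]]|[->|[v [lt eq]]]];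
  [by left|right; exists v|by left|right; apply/existsP; exists v].
- by split=> // x xv; apply/eqP; move: (eq x); rewrite ladder_var_gtE xv.
- rewrite lt; apply/forallP => x; rewrite ladder_var_gtE.
  by apply/implyP => /eq->.
Qed.

Lemma ladder_lex_refl : reflexive (@ladder_lex n m L).
Proof. by move=> u; apply/lexP; left. Qed.

Lemma ladder_lex_trans : transitive (@ladder_lex n m L).
Proof.
move=> w u z /lexP[->//|[v [lt eq]]] /lexP[<-|[v' [lt' eq']]].
  by apply/lexP; right; exists v.
apply/lexP; right; case: (ltngtP (key v) (key v')) => [vv'|v'v|/key_inj vv'].
- exists v; split; first by rewrite -(eq' _ vv').
  by move=> x xv; rewrite eq // eq' // (ltn_trans xv).
- exists v'; split; first by rewrite (eq _ v'v).
  by move=> x xv; rewrite eq ?eq' // (ltn_trans xv).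
- exists v; split; first by rewrite (ltn_trans lt) // vv'.
  by move=> x xv; rewrite eq // eq' // -vv'.
Qed.

Lemma ladder_lex_anti : antisymmetric (@ladder_lex n m L).
Proof.
move=> u w /andP[/lexP[->//|[v [lt eq]]] /lexP[->//|[v' [lt' eq']]]].
case: (ltngtP (key v) (key v')) => [vv'|v'v|/key_inj vv'].
- by move: lt; rewrite (eq' _ vv') ltnn.
- by move: lt'; rewrite (eq _ v'v) ltnn.
- by move: lt; rewrite vv' ltnNge ltnW.
Qed.

Lemma ladder_lex_total : total (@ladder_lex n m L).
Proof.
move=> u w; have [->|neq] := eqVneq u w; first by rewrite ladder_lex_refl.
have [v0 v0P] : exists v, u v != w v.
  by apply: contrapT => no; case/eqP: neq; apply/mnmP => v; apply/eqP/negPn/negP => h;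
     apply: no; exists v.
have [v vP vmin] := @arg_minnP _ v0 (fun v => u v != w v) key v0P.
have eq x : (key x < key v)%N -> u x = w x.
  by move=> xv; apply/eqP; apply: contraTT xv => /vmin; rewrite -leqNgt.
case: (ltngtP (u v) (w v)) vP => // lt _; apply/orP; [left|right];
  by apply/lexP; right; exists v; split=> // x /eq.
Qed.

Lemma ladder_lexD u w z : ladder_lex u w -> ladder_lex (u + z)%MM (w + z)%MM.
Proof.
case/lexP => [->|[v [lt eq]]]; first exact: ladder_lex_refl.
apply/lexP; right; exists v; split; first by rewrite !mnmDE ltn_add2r.
by move=> x /eq e; rewrite !mnmDE e.
Qed.

Definition lex_lt u w := ladder_lex u w && (u != w).

Lemma lex_ltD u w z : lex_lt u w -> lex_lt (u + z)%MM (w + z)%MM.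
Proof.
by case/andP=> le ne; rewrite /lex_lt ladder_lexD // eqm_add2r.
Qed.

Lemma lex_le_lt_trans u w z : ladder_lex u w -> lex_lt w z -> lex_lt u z.
Proof.
move=> uw /andP[wz ne]; rewrite /lex_lt (ladder_lex_trans uw wz).
by apply: contra ne => /eqP e; subst z; rewrite eq_sym; apply/eqP/ladder_lex_anti/andP.
Qed.

(** Total in [e]: an entry outside the ladder gives the monomial 1, hence the membership hypotheses
    in later statements. *)
Definition entry_mon e : 'X_{1..N} :=
  oapp (fun v : ladder_entry L => U_(enum_rank v)%MM) 0%MM (insub e).

Definition entry_exp u e : nat :=
  oapp (fun v : ladder_entry L => u (enum_rank v)) 0%N (insub e).

Definition row_mon (c : 'I_n -> 'I_m) : 'X_{1..N} :=
  (\big[+%MM/0%MM]_i entry_mon (i, c i))%MM.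

Definition in_ladder (c : 'I_n -> 'I_m) :=
  [forall i, (i, c i) \in (L : {set _})].

Lemma entry_expD u w e : entry_exp (u + w)%MM e = (entry_exp u e + entry_exp w e)%N.
Proof. by rewrite /entry_exp; case: insubP => //= v _ _; rewrite mnmDE. Qed.

Lemma entry_exp_mon e e' : e \in (L : {set _}) -> e' \in (L : {set _}) ->
  entry_exp (entry_mon e') e = (e' == e).
Proof.
move=> eL e'L; rewrite /entry_exp /entry_mon.
case: insubP => [v _ ve|/negP//]; case: insubP => [v' _ ve'|/negP//] /=.
by rewrite mnm1E (inj_eq enum_rank_inj) -val_eqE ve ve'.
Qed.

Lemma entry_exp_row c l j : in_ladder c -> (l, j) \in (L : {set _}) ->
  entry_exp (row_mon c) (l, j) = (c l == j).
Proof.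
move=> /forallP cL ljL.
have -> : entry_exp (row_mon c) (l, j) =
    (\sum_i entry_exp (entry_mon (i, c i)) (l, j))%N.
  rewrite /row_mon /entry_exp; case: insubP => /= [v _ _|_]; last by rewrite big1.
  by rewrite mnm_sumE.
rewrite (bigD1 l) //= entry_exp_mon // xpair_eqE eqxx big1 ?addn0 // => i il.
by rewrite entry_exp_mon // xpair_eqE (negPf il).
Qed.

Lemma entry_expP u w :
  (forall l j, (l, j) \in (L : {set _}) -> (entry_exp u (l, j) <= entry_exp w (l, j))%N) ->
  (u <= w)%MM.
Proof.
move=> le; apply/mnm_lepP => v; rewrite -[v]enum_valK.
have := valP (enum_val v); move: (le (val (enum_val v)).1 (val (enum_val v)).2).
by rewrite -surjective_pairing /entry_exp valK => h /h.
Qed.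

Lemma entry_exp_le u w e : (u <= w)%MM -> (entry_exp u e <= entry_exp w e)%N.
Proof. by move=> /mnm_lepP le; rewrite /entry_exp; case: insub => //=. Qed.

(** There is exactly one variable per row, so x_c is squarefree and divisibility only concerns
    supports. *)
Lemma row_mon_lep c u : in_ladder c ->
  (row_mon c <= u)%MM <-> (forall l, 0 < entry_exp u (l, c l))%N.
Proof.
move=> cL; split=> [le l|pos].
  apply: leq_trans (entry_exp_le (l, c l) le).
  by rewrite entry_exp_row ?eqxx //; apply: (forallP cL).
by apply: entry_expP => l j ljL; rewrite entry_exp_row //; case: eqP => // <-.
Qed.

(** Strict comparisons of products of row monomials are proved by exhibiting the first entry, in
    reading order, where the exponents differ. *)
Lemma lex_ltI u w l j : (l, j) \in (L : {set _}) ->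
  (entry_exp u (l, j) < entry_exp w (l, j))%N ->
  (forall l' j', (l', j') \in (L : {set _}) -> (l' < l)%N || (l' == l) && (j' < j)%N ->
     entry_exp u (l', j') = entry_exp w (l', j')) ->
  lex_lt u w.
Proof.
move=> ljL lt eq; apply/andP; split; last first.
  by apply: contraTneq lt => ->; rewrite ltnn.
apply/orP; right; move: lt; rewrite /entry_exp; case: insubP => [v _ ve|/negP//] /= lt.
apply/existsP; exists (enum_rank v); rewrite lt /=; apply/forallP => x; apply/implyP.
rewrite -[x]enum_valK /ladder_var_gt !enum_rankK ve.
have := valP (enum_val x); have := eq (val (enum_val x)).1 (val (enum_val x)).2.
rewrite -surjective_pairing /entry_exp valK /= => h /h{}h.
by rewrite [val (enum_val x)]surjective_pairing /= => /h->.
Qed.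

Lemma mdeg_entry_mon e : e \in (L : {set _}) -> mdeg (entry_mon e) = 1%N.
Proof. by move=> eL; rewrite /entry_mon; case: insubP => [v _ _|/negP//]; rewrite /= mdeg1. Qed.

Lemma mdeg_row_mon c : in_ladder c -> mdeg (row_mon c) = n.
Proof.
move=> /forallP cL; rewrite /row_mon mdeg_sum.
under eq_bigr => i _ do rewrite mdeg_entry_mon //.
by rewrite sum1_card card_ord.
Qed.

End LadderLex.

(** * Maximal minors of a ladder matrix *)

Lemma gt_ord_eqF n (i j : 'I_n) : (i < j)%N -> (j == i) = false.
Proof. by move=> ij; apply/eqP => e; rewrite e ltnn in ij. Qed.

(* Cramer's rule, from [A *m \adj A = \det A]. *)
Lemma det_replace_col (R : comNzRingType) (n m : nat) (X : 'M[R]_(n, m))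
    (a : 'I_n -> 'I_m) (v : 'I_m) (i : 'I_n) :
  X i v * \det (colsub a X) =
  \sum_k X i (a k) * \det (colsub (fun j => if j == k then v else a j) X).
Proof.
set A := colsub a X.
have -> : X i v * \det A = (A *m (\adj A *m col v X)) i 0.
  by rewrite mulmxA mul_mx_adj mul_scalar_mx !mxE mulrC.
rewrite mxE; apply: eq_bigr => k _; rewrite !mxE; congr (_ * _).
rewrite (expand_det_col _ k); apply: eq_bigr => l _; rewrite !mxE eqxx mulrC.
congr (_ * ((-1) ^+ (l + k) * \det _)).
by apply/matrixP => x y; rewrite !mxE eq_sym (negPf (neq_lift _ _)).
Qed.

Lemma sort_injective n m (f : 'I_n -> 'I_m) : injective f ->
  exists s : 'S_n, increasing [tuple f (s i) | i < n].
Proof.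
move=> f_inj; pose t := [tuple f i | i < n].
have /tuple_permP[s es] : perm_eq (sort (fun x y : 'I_m => x <= y)%N t) t.
  by rewrite perm_sort.
exists s; apply/forallP => i; apply/forallP => j; apply/implyP => ij.
set u := [tuple _ | _ < _].
have eu : val u = sort (fun x y : 'I_m => x <= y)%N t.
  by rewrite es; congr val; apply: eq_from_tnth => k; rewrite !tnth_mktuple.
(* A sorted list without repetitions is strictly sorted. *)
have st : sorted (fun x y : 'I_m => x < y)%N u.
  have -> : (fun x y : 'I_m => x < y)%N = (fun x y => (y != x) && (x <= y)%N).
    by apply/funext => x; apply/funext => y; rewrite ltn_neqAle eq_sym.
  rewrite eu; have : uniq (sort (fun x y : 'I_m => x <= y)%N t).
    by rewrite sort_uniq map_inj_uniq // enum_uniq.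
  have : sorted (fun x y : 'I_m => x <= y)%N (sort (fun x y : 'I_m => x <= y)%N t).
    by apply: sort_sorted => x y; exact: leq_total.
  elim: (sort _ _) => //= x [//|y r] IH /= /andP[xy yr] /andP[].
  rewrite inE negb_or => /andP[xney _] /andP[yr' ur].
  by rewrite xy eq_sym xney /=; apply: IH => //=; rewrite yr'.
rewrite !(tnth_nth (f i)).
have tr : transitive (fun x y : 'I_m => x < y)%N by move=> x y z; apply: ltn_trans.
by apply: (sorted_ltn_nth tr _ st) => //; rewrite inE size_tuple.
Qed.

Section Minors.

Variables (n m : nat) (K : fieldType) (L : ladder n m).
Local Notation N := #|{: ladder_entry L}|.
Local Notation minor f := (\det (colsub f (ladder_mx K L))).
Implicit Types (a b c : ladder_cols K L) (f g : 'I_n -> 'I_m).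

Lemma increasingP (a : n.-tuple 'I_m) : reflect
  (forall i j : 'I_n, (i < j)%N -> (tnth a i < tnth a j)%N) (increasing a).
Proof.
apply: (iffP forallP) => [H i j|H i]; first by move/forallP/(_ j)/implyP: (H i).
by apply/forallP => j; apply/implyP/H.
Qed.

Lemma cols_lt a (i j : 'I_n) : (i < j)%N -> (tnth a i < tnth a j)%N.
Proof. by have /andP[/increasingP inc _] := valP a; apply: inc. Qed.

Lemma cols_in a : in_ladder L (tnth a).
Proof. by have /andP[inc] := valP a; rewrite minor_neq0. Qed.

Lemma cols_exist (f : 'I_n -> 'I_m) : (forall i j : 'I_n, (i < j)%N -> (f i < f j)%N) ->
  in_ladder L f -> exists a : ladder_cols K L, tnth a =1 f.
Proof.
move=> inc inL; pose t : n.-tupleprod 'I_m := [tuple f i | i < n].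
have tP : t \in @ladder_cols_pred n m K L.
  have inct : increasing t by apply/increasingP => i j; rewrite !tnth_mktuple; apply: inc.
  rewrite unfold_in /ladder_cols_pred inct minor_neq0 //=; apply/forallP => i.
  by rewrite tnth_mktuple (forallP inL).
by exists (LadderCols tP) => i; rewrite tnth_mktuple.
Qed.

Lemma cols_inj a : injective (tnth a).
Proof.
move=> i j e; apply: val_inj; case: (ltngtP i j) => // /(cols_lt a);
  by rewrite e ltnn.
Qed.

Lemma ladder_mx_prod f :
  \prod_i ladder_mx K L i (f i) = if in_ladder L f then 'X_[row_mon L f] else 0.
Proof.
case: ifPn => [/forallP ok|/forallPn[i nok]]; last first.
  by rewrite (bigD1 i) //= mxE insubN // mul0r.
rewrite -mprodXE; apply: eq_bigr => i _; rewrite mxE /entry_mon.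
by case: insubP => [v _ _ //|]; rewrite ok.
Qed.

Lemma ladder_mxE i j : (i, j) \in (L : {set _}) ->
  ladder_mx K L i j = 'X_[entry_mon L (i, j)].
Proof. by move=> ijL; rewrite mxE /entry_mon; case: insubP => // /negP. Qed.

Lemma ladder_mx0 i j : (i, j) \notin (L : {set _}) -> ladder_mx K L i j = 0.
Proof. by move=> ijL; rewrite mxE insubN. Qed.

Lemma minorE f : minor f = \sum_(s : 'S_n)
  (-1) ^+ s *: (if in_ladder L (f \o s) then 'X_[row_mon L (f \o s)] else 0).
Proof.
apply: eq_bigr => s _; rewrite -ladder_mx_prod.
rewrite -mul_mpolyC rmorphXn rmorphN1.
by congr (_ * _); apply: eq_bigr => i _; rewrite !mxE.
Qed.

Lemma minor_msupp f u : u \in msupp (minor f) ->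
  exists2 s : 'S_n, in_ladder L (f \o s) & u = row_mon L (f \o s).
Proof.
rewrite mcoeff_msupp minorE raddf_sum => H; apply: contrapT => nos.
case/eqP: H; apply: big1 => s _ /=; rewrite mcoeffZ.
case: ifP => oks; last by rewrite mcoeff0 mulr0.
rewrite mcoeffX; case: eqP => [e|_]; last by rewrite mulr0.
by case: nos; exists s.
Qed.

(** The first row [i] moved by [s] satisfies s(i) > i, so x_{i,a_i} is missing from the permuted
    monomial, while all earlier exponents agree. *)
Lemma row_mon_perm_lt a (s : 'S_n) : in_ladder L (tnth a \o s) -> s != 1%g ->
  lex_lt (row_mon L (tnth a \o s)) (row_mon L (tnth a)).
Proof.
move=> oks s1.
have [i0 si0] : exists i, s i != i.
  apply: contrapT => no; case/eqP: s1; apply/permP => i; rewrite perm1.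
  by apply/eqP/negPn/negP => si; apply: no; exists i.
have [i si imin] := @arg_minnP _ i0 (fun i => s i != i) (@nat_of_ord n) si0.
have fixlt (k : 'I_n) : (k < i)%N -> s k = k.
  by move=> ki; apply/eqP; apply: contraTT ki => /imin; rewrite -leqNgt.
have lt_isi : (i < s i)%N.
  rewrite ltn_neqAle eq_sym (inj_eq val_inj) si leqNgt; apply/negP => /fixlt.
  by move=> /perm_inj e; rewrite e eqxx in si.
have aL := cols_in a.
apply: (@lex_ltI _ _ _ _ _ i (tnth a i)); first exact: (forallP aL).
  rewrite !entry_exp_row ?(forallP aL) //= eqxx.
  by rewrite (inj_eq (@cols_inj a)) (negPf si).
move=> l j ljL; rewrite !entry_exp_row //=.
case/orP => [/fixlt-> //|/andP[/eqP-> lt]].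
by rewrite !gt_ord_eqF // (ltn_trans lt) // cols_lt.
Qed.

Lemma minor_msupp_le a u : u \in msupp (maximal_minor K L a) ->
  ladder_lex u (row_mon L (tnth a)).
Proof.
case/minor_msupp => s oks ->; have [->|s1] := eqVneq s 1%g; last first.
  by have /andP[] := row_mon_perm_lt oks s1.
have -> : row_mon L (tnth a \o (1%g : 'S_n)) = row_mon L (tnth a).
  by apply: eq_bigr => i _; rewrite /= perm1.
exact: ladder_lex_refl.
Qed.

Lemma minor_lead_coef a : (maximal_minor K L a)@_(row_mon L (tnth a)) = 1.
Proof.
have e1 : tnth a \o (1%g : 'S_n) = tnth a by apply/funext => i; rewrite /= perm1.
rewrite [maximal_minor _ _ _]minorE raddf_sum (bigD1 1%g) //= e1 cols_in mcoeffZ.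
rewrite odd_perm1 expr0 mul1r mcoeffX eqxx big1 ?addr0 // => s s1.
rewrite mcoeffZ; case: ifP => oks; last by rewrite mcoeff0 mulr0.
have /andP[_] := row_mon_perm_lt oks s1.
by rewrite mcoeffX => /negPf->; rewrite mulr0.
Qed.

(** Sorting the columns costs only a sign, and the sorted tuple either lies in [ladder_cols] or has
    minor zero. *)
Lemma minor_sorted f : injective f -> minor f = 0 \/
  exists (s : 'S_n) c, tnth c =1 f \o s /\ minor f = (-1) ^+ s *: maximal_minor K L c.
Proof.
move=> f_inj; have [s inc] := sort_injective f_inj; set t := [tuple _ | _ < _] in inc.
have e : maximal_minor K L t = (-1) ^+ s *: minor f.
  have -> : maximal_minor K L t = \det (col_perm s (colsub f (ladder_mx K L))).
    by congr (\det _); apply/matrixP => i j; rewrite !mxE tnth_mktuple.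
  rewrite col_permE det_mulmx det_perm odd_permV mulrC -mul_mpolyC.
  by rewrite rmorphXn rmorphN1.
have e' : minor f = (-1) ^+ s *: maximal_minor K L t.
  by rewrite e scalerA -expr2 sqrr_sign scale1r.
have [z|nz] := eqVneq (maximal_minor K L t) 0; [left|right].
  by rewrite e' z scaler0.
have tP : (t : n.-tupleprod 'I_m) \in @ladder_cols_pred n m K L by apply/andP.
by exists s, (LadderCols tP); split=> // i; rewrite tnth_mktuple.
Qed.

(** Polynomial coefficients are split into scalars times monomials, so that each term has one
    leading monomial, [term_lead]. *)
Definition minor_comb (s : seq (K * 'X_{1..N} * ladder_cols K L)) : {mpoly K[N]} :=
  \sum_(t <- s) t.1.1 *: ('X_[t.1.2] * maximal_minor K L t.2).

Definition term_lead (t : K * 'X_{1..N} * ladder_cols K L) : 'X_{1..N} :=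
  (t.1.2 + row_mon L (tnth t.2))%MM.

(* [p] reduces, within the degree of [M], to terms smaller than [M]. *)
Definition below M (p : {mpoly K[N]}) := exists s, p = minor_comb s /\
  forall t, t \in s -> lex_lt (term_lead t) M /\ mdeg (term_lead t) = mdeg M.

Lemma below0 M : below M 0.
Proof. by exists [::]; rewrite /minor_comb big_nil. Qed.

Lemma belowD M p q : below M p -> below M q -> below M (p + q).
Proof.
move=> [s [-> sP]] [t [-> tP]]; exists (s ++ t); split.
  by rewrite /minor_comb big_cat.
by move=> x; rewrite mem_cat => /orP[/sP|/tP].
Qed.

Lemma belowZ M (x : K) p : below M p -> below M (x *: p).
Proof.
move=> [s [-> sP]]; exists [seq (x * t.1.1, t.1.2, t.2) | t <- s]; split.
  rewrite /minor_comb big_map scaler_sumr; apply: eq_bigr => t _.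
  by rewrite /= scalerA.
by move=> _ /mapP[t /sP tP ->].
Qed.

Lemma below_sum M (I : eqType) (r : seq I) (P : pred I) (F : I -> {mpoly K[N]}) :
  (forall i, i \in r -> P i -> below M (F i)) -> below M (\sum_(i <- r | P i) F i).
Proof.
move=> H; rewrite big_seq_cond; apply: big_ind; [exact: below0|exact: belowD|].
by move=> i /andP[]; apply: H.
Qed.

Lemma belowMX M w p : below M p -> below (M + w)%MM ('X_[w] * p).
Proof.
move=> [s [-> sP]]; exists [seq (t.1.1, (t.1.2 + w)%MM, t.2) | t <- s]; split.
  rewrite /minor_comb big_map mulr_sumr; apply: eq_bigr => t _ /=.
  by rewrite mpolyXD -scalerAr; congr (_ *: _); rewrite mulrCA mulrA.
move=> _ /mapP[t /sP[lt dg] ->].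
have -> : term_lead (t.1.1, (t.1.2 + w)%MM, t.2) = (term_lead t + w)%MM.
  by rewrite /term_lead /= -!addmA [(w + _)%MM]addmC.
by rewrite lex_ltD //; split=> //; rewrite mdegD dg mdegD.
Qed.

(** The left side is the leading monomial of the k-th summand, k different from i, when Cramer's
    rule is applied to x_{i,v} [a]. The proof locates the first entry where the two monomials
    differ. *)
Lemma exchange_lt a (v : 'I_m) (i k : 'I_n) c (s : 'S_n) :
    (forall l : 'I_n, (l < i)%N -> (tnth a l < v)%N) -> (v < tnth a i)%N ->
    (i, v) \in (L : {set _}) -> k != i -> (i, tnth a k) \in (L : {set _}) ->
    tnth c =1 (fun j => if j == k then v else tnth a j) \o s ->
  lex_lt (entry_mon L (i, tnth a k) + row_mon L (tnth c))%MM
         (entry_mon L (i, v) + row_mon L (tnth a))%MM.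
Proof.
move=> lev ltv ivL ki ikL cE.
have aL := cols_in a; have cL := cols_in c.
have eE l j : (l, j) \in (L : {set _}) ->
    entry_exp (entry_mon L (i, tnth a k) + row_mon L (tnth c))%MM (l, j) =
    (((i == l) && (tnth a k == j)) + (tnth c l == j))%N.
  by move=> ljL; rewrite entry_expD entry_exp_mon // entry_exp_row // xpair_eqE.
have eM l j : (l, j) \in (L : {set _}) ->
    entry_exp (entry_mon L (i, v) + row_mon L (tnth a))%MM (l, j) =
    (((i == l) && (v == j)) + (tnth a l == j))%N.
  by move=> ljL; rewrite entry_expD entry_exp_mon // entry_exp_row // xpair_eqE.
(* [v] lies strictly between the columns of [a] in rows before [i] and those from row [i] on. *)
have va l : v != tnth a l.
  case: (ltnP l i) => [/lev/gt_ord_eqF->//|il]; rewrite eq_sym gt_ord_eqF //.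
  move: il; rewrite leq_eqVlt => /orP[/eqP/val_inj <- //|/(cols_lt a)].
  exact: ltn_trans.
have cNk l : tnth c l != tnth a k.
  rewrite cE /=; have [_|slk] := eqVneq (s l) k; first exact: va.
  by rewrite (inj_eq (@cols_inj a)).
have cV l : tnth c l = v \/ exists2 j, j != k & tnth c l = tnth a j.
  by rewrite cE /=; have [_|jk] := eqVneq (s l) k; [left|right; exists (s l)].
(* If [c] and [a] differ before row [i], then in the first such row [l] the column of [c] is [v] or
   some a_j with j > l, the earlier ones being taken. Thus x_{l,a_l} is missing on the left. *)
have [/existsP[l0 l0P]|] := boolP [exists l : 'I_n, (l < i)%N && (tnth c l != tnth a l)].
  have [l /andP[li cl] lmin] :=
    @arg_minnP _ l0 (fun l => (l < i)%N && (tnth c l != tnth a l)) (@nat_of_ord n) l0P.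
  have fixlt (j : 'I_n) : (j < l)%N -> tnth c j = tnth a j.
    move=> jl; apply/eqP; apply: contraTT jl => cj; rewrite -leqNgt.
    have [ji|ij] := ltnP j i; first by apply: lmin; rewrite ji.
    by apply: leq_trans ij; apply: ltnW.
  have il : (i == l) = false by rewrite gt_ord_eqF.
  have lt : (tnth a l < tnth c l)%N.
    have [->|[j jk e]] := cV l; first exact: lev.
    rewrite e; apply: cols_lt; rewrite ltnNge leq_eqVlt negb_or -leqNgt.
    apply/andP; split; first by apply: contra cl => /eqP/val_inj ejl; rewrite e ejl.
    rewrite leqNgt; apply/negP => jl; move: (fixlt _ jl); rewrite -e => /cols_inj ejl.
    by rewrite ejl ltnn in jl.
  apply: (@lex_ltI _ _ _ _ _ l (tnth a l)); first exact: (forallP aL).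
    by rewrite eE ?eM ?(forallP aL) // il /= eqxx gt_ord_eqF.
  move=> l' j' lL /orP[l'l|/andP[/eqP El j'l]]; rewrite eE ?eM //.
    by rewrite (fixlt _ l'l) [i == l']gt_ord_eqF // (ltn_trans l'l).
  by rewrite El il /= !gt_ord_eqF // (ltn_trans j'l).
move=> /existsPn nol.
have fixlt (l : 'I_n) : (l < i)%N -> tnth c l = tnth a l.
  by move=> li; apply/eqP; have := nol l; rewrite li /= negbK.
(* The column a_k no longer occurs in [c], although [c] agrees with [a] before row [i]. *)
have ik : (i < k)%N.
  rewrite ltnNge leq_eqVlt negb_or (inj_eq val_inj) ki /= -leqNgt leqNgt.
  by apply/negP => /fixlt e; have := cNk k; rewrite e eqxx.
have aik := cols_lt a ik.
(* If c_i = v, then x_{i,v} occurs on both sides, and the first difference is x_{i,a_i} on the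
   right, as a_k > a_i. *)
have [civ|civ] := eqVneq (tnth c i) v.
  apply: (@lex_ltI _ _ _ _ _ i (tnth a i)); first exact: (forallP aL).
    rewrite eE ?eM ?(forallP aL) // civ eqxx /= eqxx (negPf (va i)) addn0.
    by rewrite gt_ord_eqF.
  move=> l' j' lL /orP[l'l|/andP[/eqP El j'l]]; rewrite eE ?eM //.
    by rewrite (fixlt _ l'l) [i == l']gt_ord_eqF.
  by rewrite El eqxx /= civ [tnth a i == _]gt_ord_eqF // gt_ord_eqF ?add0n ?addn0 // (ltn_trans j'l).
(* Otherwise c_i is some a_j >= a_i > v, and x_{i,v} is missing on the left. *)
have vci : (v < tnth c i)%N.
  have [e|[j jk e]] := cV i; first by rewrite e eqxx in civ.
  rewrite e; apply: leq_trans ltv _; rewrite leqNgt; apply/negP => aji.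
  have [ji|] := ltnP j i.
    by move: e; rewrite -(fixlt _ ji) => /cols_inj ej; rewrite ej ltnn in ji.
  rewrite leq_eqVlt => /orP[/eqP/val_inj eji|/(cols_lt a)].
    by rewrite eji ltnn in aji.
  by move=> /ltnW; rewrite leqNgt aji.
apply: (@lex_ltI _ _ _ _ _ i v) => //.
  rewrite eE ?eM // !eqxx /= (negPf civ).
  by rewrite gt_ord_eqF // (ltn_trans ltv).
move=> l' j' lL /orP[l'l|/andP[/eqP El j'l]]; rewrite eE ?eM //.
  by rewrite (fixlt _ l'l) [i == l']gt_ord_eqF.
rewrite El eqxx /= [v == _]gt_ord_eqF // [tnth a i == _]gt_ord_eqF; last exact: ltn_trans ltv.
rewrite [tnth a k == _]gt_ord_eqF; last exact: ltn_trans (ltn_trans j'l ltv) aik.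
by rewrite gt_ord_eqF // (ltn_trans j'l).
Qed.

(** When x_{i,v} [a] is expanded by [det_replace_col], the summand k = i is x_{i,a_i} [a'] and
    cancels. The others vanish or are smaller by [exchange_lt]. *)
Lemma below_exchange a a' (i : 'I_n) (v : 'I_m) : (v < tnth a i)%N ->
    tnth a' =1 (fun l => if l == i then v else tnth a l) ->
  below (entry_mon L (i, v) + row_mon L (tnth a))%MM
    ('X_[entry_mon L (i, v)] * maximal_minor K L a -
     'X_[entry_mon L (i, tnth a i)] * maximal_minor K L a').
Proof.
move=> ltv a'E; have a'i : tnth a' i = v by rewrite a'E eqxx.
have ivL : (i, v) \in (L : {set _}) by rewrite -a'i (forallP (cols_in a')).
have lev (l : 'I_n) : (l < i)%N -> (tnth a l < v)%N.
  move=> li; have := cols_lt a' li; rewrite a'i a'E; case: eqP => // e.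
  by rewrite e ltnn in li.
have va l : v != tnth a l.
  case: (ltnP l i) => [/lev/gt_ord_eqF->//|il]; rewrite eq_sym gt_ord_eqF //.
  move: il; rewrite leq_eqVlt => /orP[/eqP/val_inj <- //|/(cols_lt a)].
  exact: ltn_trans.
rewrite -!ladder_mxE // ?(forallP (cols_in a)) // [X in X - _]det_replace_col.
have -> : maximal_minor K L a' =
    \det (colsub (fun l => if l == i then v else tnth a l) (ladder_mx K L)).
  by rewrite /maximal_minor; congr (\det (colsub _ _)); apply/funext.
rewrite (bigD1 i) //= addrAC subrr add0r.
apply: below_sum => k _ ki.
have [ikL|ikL] := boolP ((i, tnth a k) \in (L : {set _})); last first.
  by rewrite ladder_mx0 // mul0r; apply: below0.
(* As [v] is not a column of [a], the new columns are distinct and can be sorted. *)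
have inj : injective (fun j => if j == k then v else tnth a j).
  move=> x y; case: eqP => [->|_]; case: eqP => [->|_] //.
  - by move=> /eqP; rewrite (negPf (va _)).
  - by move=> /esym/eqP; rewrite (negPf (va _)).
  - exact: cols_inj.
have [->|[s [c [cE ->]]]] := minor_sorted inj; first by rewrite mulr0; apply: below0.
rewrite -scalerAr; apply: belowZ; exists [:: (1, entry_mon L (i, tnth a k), c)].
split; first by rewrite /minor_comb big_seq1 scale1r ladder_mxE.
move=> _ /[1!inE]/eqP->; rewrite /term_lead /=; split.
  exact: exchange_lt cE.
by rewrite !mdegD !mdeg_entry_mon // !mdeg_row_mon // cols_in.
Qed.

(** Hence the two products subtracted in [below_exchange] share their leading monomial. *)
Lemma row_mon_exchange a a' (i : 'I_n) (v : 'I_m) :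
    tnth a' =1 (fun l => if l == i then v else tnth a l) ->
  (entry_mon L (i, tnth a i) + row_mon L (tnth a') =
   entry_mon L (i, v) + row_mon L (tnth a))%MM.
Proof.
move=> a'E; rewrite /row_mon (bigD1 i) // [in RHS](bigD1 i) //= a'E eqxx.
rewrite [LHS]addmA [RHS]addmA [(entry_mon L (i, v) + _)%MM]addmC; congr (_ + _)%MM.
by apply: eq_bigr => l li; rewrite a'E (negPf li).
Qed.

(** Induction on the number of rows where [a] and [c] differ: in the first such row, a_i is lowered
    to c_i. The new tuple takes each column from [a] or [c], so its monomial still divides [M]. *)
Lemma below_le M a c : (row_mon L (tnth a) <= M)%MM -> (row_mon L (tnth c) <= M)%MM ->
    (forall i, tnth c i <= tnth a i)%N ->
  below M ('X_[M - row_mon L (tnth a)] * maximal_minor K L a -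
           'X_[M - row_mon L (tnth c)] * maximal_minor K L c).
Proof.
move: {2}_.+1 (ltnSn #|[set i | tnth a i != tnth c i]|) => k.
elim: k a => // k IH a; rewrite ltnS => cardk aM cM ca.
have [/eqP|] := boolP ([set i | tnth a i != tnth c i] == set0).
  move/setP => e; have -> : a = c.
    apply: val_inj; apply: eq_from_tnth => i; apply/eqP.
    by have := e i; rewrite !inE => /negPn.
  by rewrite subrr; apply: below0.
case/set0Pn => i0; rewrite inE => i0P.
have [i ai imin] := @arg_minnP _ i0 (fun i => tnth a i != tnth c i) (@nat_of_ord n) i0P.
have eqlt (l : 'I_n) : (l < i)%N -> tnth a l = tnth c l.
  by move=> li; apply/eqP; apply: contraTT li => /imin; rewrite -leqNgt.
have lt : (tnth c i < tnth a i)%N.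
  by rewrite ltn_neqAle (inj_eq val_inj) eq_sym ai ca.
(* The tuple stays increasing because [a] agrees with [c] before row [i] and c_i < a_i. *)
have [a' a'E] : exists a' : ladder_cols K L,
    tnth a' =1 (fun l => if l == i then tnth c i else tnth a l).
  apply: cols_exist => [x y xy|].
    have [xi|xi] := eqVneq x i; have [yi|yi] := eqVneq y i.
    - by rewrite xi yi ltnn in xy.
    - by rewrite -xi in lt *; apply: ltn_trans lt (cols_lt a xy).
    - by rewrite yi in xy *; rewrite eqlt //; apply: cols_lt.
    - exact: cols_lt.
  apply/forallP => x; have [->|_] := eqVneq x i; first exact: (forallP (cols_in c)).
  exact: (forallP (cols_in a)).
have posa := (row_mon_lep _ (cols_in a)).1 aM.
have posc := (row_mon_lep _ (cols_in c)).1 cM.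
have a'M : (row_mon L (tnth a') <= M)%MM.
  apply/(row_mon_lep _ (cols_in a')) => l; rewrite a'E.
  by have [->|_] := eqVneq l i.
(* In row [i], x_{i,a_i} and x_{i,c_i} are distinct variables, both dividing [M]. *)
have eM : (entry_mon L (i, tnth c i) + row_mon L (tnth a) <= M)%MM.
  apply: entry_expP => l j ljL; rewrite entry_expD entry_exp_mon ?(forallP (cols_in c)) //.
  rewrite entry_exp_row ?cols_in // xpair_eqE.
  have [ail|_] := eqVneq i l; last by rewrite add0n; case: eqP => // <-.
  subst l; rewrite /=; case: eqP => [<-|_]; first by rewrite (negPf ai).
  by rewrite add0n; case: eqP => // <-.
pose w := (M - (entry_mon L (i, tnth c i) + row_mon L (tnth a)))%MM.
have ea : (M - row_mon L (tnth a) = w + entry_mon L (i, tnth c i))%MM.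
  by rewrite -[in LHS](submK eM) -/w [in LHS]addmA addmK.
have ea' : (M - row_mon L (tnth a') = w + entry_mon L (i, tnth a i))%MM.
  by rewrite -[in LHS](submK eM) -/w -(row_mon_exchange a'E) [in LHS]addmA addmK.
have b1 : below M ('X_[M - row_mon L (tnth a)] * maximal_minor K L a -
                   'X_[M - row_mon L (tnth a')] * maximal_minor K L a').
  have := belowMX w (below_exchange lt a'E).
  rewrite addmC (submK eM) mulrBr ea ea'.
  by rewrite (mpolyXD _ w (entry_mon L (i, tnth c i))) (mpolyXD _ w (entry_mon L (i, tnth a i)))
    -(mulrA 'X_[w]) -(mulrA 'X_[w]).
rewrite -[X in below M (X - _)](subrK ('X_[M - row_mon L (tnth a')] * maximal_minor K L a')).
rewrite -addrA; apply: belowD b1 _; apply: IH => //; last first.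
  by move=> l; rewrite a'E; have [->|_] := eqVneq l i.
apply: leq_trans cardk; apply: proper_card; apply/properP; split.
  apply/subsetP => l; rewrite !inE a'E; by have [->|_] := eqVneq l i.
by exists i; rewrite !inE // a'E !eqxx.
Qed.

(** The meet takes each column from [a] or [b], so its monomial divides [M] and [below_le] applies
    on both sides. *)
Lemma below_connect M a b : (row_mon L (tnth a) <= M)%MM -> (row_mon L (tnth b) <= M)%MM ->
  below M ('X_[M - row_mon L (tnth a)] * maximal_minor K L a -
           'X_[M - row_mon L (tnth b)] * maximal_minor K L b).
Proof.
move=> aM bM; pose c : ladder_cols K L := (a `&` b)%O.
have cE i : tnth c i = if (tnth a i < tnth b i)%N then tnth a i else tnth b i.
  transitivity (tnth (val a `&` val b)%O i) => //.
  by rewrite Order.TupleProdOrder.tnth_meet meetEtotal.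
have cM : (row_mon L (tnth c) <= M)%MM.
  apply/(row_mon_lep _ (cols_in c)) => l; rewrite cE.
  have posa := (row_mon_lep _ (cols_in a)).1 aM.
  have posb := (row_mon_lep _ (cols_in b)).1 bM.
  by case: ifP.
have ca i : (tnth c i <= tnth a i)%N by rewrite cE; case: ltnP.
have cb i : (tnth c i <= tnth b i)%N by rewrite cE; case: ltnP => // /ltnW.
have h1 := below_le aM cM ca; have h2 := belowZ (-1) (below_le bM cM cb).
have := belowD h1 h2; rewrite scaleN1r opprB addrA subrK; exact.
Qed.

Lemma term_msupp_le (t : K * 'X_{1..N} * ladder_cols K L) u :
  u \in msupp ('X_[t.1.2] * maximal_minor K L t.2) -> ladder_lex u (term_lead t).
Proof.
rewrite mulrC (perm_mem (msuppMX _ _)) => /mapP[v /minor_msupp_le le ->].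
by rewrite /term_lead [(t.1.2 + v)%MM]addmC [(t.1.2 + row_mon L _)%MM]addmC ladder_lexD.
Qed.

Lemma max_term (s : seq (K * 'X_{1..N} * ladder_cols K L)) : s != [::] ->
  exists2 t, t \in s & forall t', t' \in s -> ladder_lex (term_lead t') (term_lead t).
Proof.
elim: s => // x [_ _|y s /(_ isT)[t ts tmax] _].
  by exists x; rewrite ?mem_head // => t /[1!inE]/eqP->; apply: ladder_lex_refl.
have /orP[xt|tx] := ladder_lex_total (term_lead x) (term_lead t).
  exists t; first by rewrite inE ts orbT.
  by move=> t' /[1!inE]/orP[/eqP->|/tmax].
exists x; first exact: mem_head.
move=> t' /[1!inE]/orP[/eqP->|/tmax le].
  exact: ladder_lex_refl.
exact: ladder_lex_trans le tx.
Qed.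

(** Buchberger's argument: the terms with leading monomial [M] merge into one multiple [C *: B], up
    to terms below [M]. If [C] is nonzero, [M] is the initial monomial; otherwise the bound [M] can
    be lowered. *)
Lemma minor_comb_initial (D : nat) (M : 'X_{1..N}) s :
    (forall t, t \in s -> ladder_lex (term_lead t) M /\ (mdeg (term_lead t) <= D)%N) ->
    minor_comb s != 0 ->
  exists u a, initial_monomial (@ladder_lex n m L) (minor_comb s) u /\
              (row_mon L (tnth a) <= u)%MM.
Proof.
(* Degrees stay below [D], so only finitely many monomials lie below [M]. *)
move: {2}_.+1 (ltnSn #|[set u : 'X_{1..N < D.+1} | lex_lt (u : 'X_{1..N}) M]|) => k.
elim: k M s => // k IH M s; rewrite ltnS => cardk sP nz.
(* Once all terms lie strictly below [M], their largest leading monomial is the new bound. It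
   belongs to the counted set for [M] but not to its own, so the count drops. *)
have low s' : minor_comb s = minor_comb s' ->
    (forall t, t \in s' -> lex_lt (term_lead t) M /\ (mdeg (term_lead t) <= D)%N) ->
  exists u a, initial_monomial (@ladder_lex n m L) (minor_comb s) u /\
              (row_mon L (tnth a) <= u)%MM.
  move=> e s'P; rewrite e in nz *.
  have [t ts tmax] : exists2 t, t \in s' &
      forall t', t' \in s' -> ladder_lex (term_lead t') (term_lead t).
    by apply: max_term; apply: contraNneq nz => ->; rewrite /minor_comb big_nil.
  have [tM tD] := s'P t ts.
  apply: (IH (term_lead t)) => //; last by move=> t' t's; have [] := s'P t' t's; auto.
  apply: leq_trans cardk; apply: proper_card; apply/properP; split.
    apply/subsetP => u; rewrite !inE => /andP[/lex_le_lt_trans + _]; exact.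
  have tD' : (mdeg (term_lead t) < D.+1)%N by [].
  by exists (BMultinom tD'); rewrite inE //= /lex_lt eqxx andbF.
have [/hasP[t0 t0s /eqP t0M]|/hasPn nM] := boolP (has (fun t => term_lead t == M) s); last first.
  apply: (low s) => // t ts; have [le dg] := sP t ts.
  by rewrite /lex_lt le (nM _ ts).
have MD : (mdeg M <= D)%N by rewrite -t0M; case: (sP t0 t0s).
have leadM t : term_lead t = M -> (row_mon L (tnth t.2) <= M)%MM /\
    t.1.2 = (M - row_mon L (tnth t.2))%MM.
  by move=> <-; rewrite /term_lead addmK lem_addl.
pose C := \sum_(t <- s | term_lead t == M) t.1.1.
pose B := 'X_[M - row_mon L (tnth t0.2)] * maximal_minor K L t0.2.
have [s1 [e1 s1P]] : below M
    (\sum_(t <- s | term_lead t == M) t.1.1 *: ('X_[t.1.2] * maximal_minor K L t.2 - B)).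
  apply: below_sum => t ts /eqP tM; apply: belowZ.
  have [le ->] := leadM _ tM; apply: below_connect => //.
  by have [] := leadM _ t0M.
pose s3 := [seq t <- s | term_lead t != M] ++ s1.
have e3 : minor_comb s = C *: B + minor_comb s3.
  rewrite /minor_comb /s3 big_cat /= big_filter -/(minor_comb s1) -e1.
  rewrite [in LHS](bigID (fun t => term_lead t == M)) /= [RHS]addrCA [RHS]addrC.
  congr (_ + _); rewrite /C scaler_suml -big_split /=; apply: eq_bigr => t _.
  by rewrite -scalerDr addrC subrK.
have s3P t : t \in s3 -> lex_lt (term_lead t) M /\ (mdeg (term_lead t) <= D)%N.
  rewrite mem_cat mem_filter => /orP[/andP[tM /sP[le dg]]|/s1P[lt ->]] //.
  by rewrite /lex_lt le tM.
have [C0|C0] := eqVneq C 0; first by apply: (low s3) => //; rewrite e3 C0 scale0r add0r.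
have ltM u : u \in msupp (minor_comb s3) -> lex_lt u M.
  rewrite /minor_comb => us.
  apply: contraTT us => nlt; rewrite -mcoeff_eq0 raddf_sum big_seq big1 //= => t ts.
  rewrite mcoeffZ memN_msupp_eq0 ?mulr0 //; apply: contra nlt => /term_msupp_le le.
  by apply: lex_le_lt_trans le _; case: (s3P _ ts).
have [le0 e0] := leadM _ t0M.
have coefM : (minor_comb s)@_M = C.
  rewrite e3 mcoeffD mcoeffZ [X in _ + X]memN_msupp_eq0 ?addr0; last first.
    by apply/negP => /ltM; rewrite /lex_lt eqxx andbF.
  by rewrite /B (mulrC 'X_[_]) -[X in mcoeff X _](submK le0) mcoeffMX minor_lead_coef mulr1.
exists M, t0.2; split=> //; split; first by rewrite mcoeff_msupp coefM.
move=> u; rewrite e3 => /msuppD_le; rewrite mem_cat => /orP[/msuppZ_le|/ltM/andP[]//].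
rewrite /B -e0 => /term_msupp_le; by rewrite t0M.
Qed.

Lemma minors_ideal_comb (p : {mpoly K[N]}) : minors_ideal p -> exists s, p = minor_comb s.
Proof.
move=> [r [rP ->]].
have: forall q, q \in r -> exists s, q.1 * q.2 = minor_comb s.
  move=> q /rP[a [inc ->]]; have [z|nz] := eqVneq (maximal_minor K L a) 0.
    by exists [::]; rewrite z mulr0 /minor_comb big_nil.
  have aP : (a : n.-tupleprod 'I_m) \in @ladder_cols_pred n m K L by apply/andP.
  exists [seq (q.1@_u, u, LadderCols aP) | u <- msupp q.1].
  rewrite /minor_comb big_map /= {1}[q.1]mpolyE mulr_suml; apply: eq_bigr => u _.
  by rewrite -scalerAl.
elim: r {rP} => [_|q r IH H]; first by exists [::]; rewrite /minor_comb !big_nil.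
have [s1 e1] := H q (mem_head _ _).
have [|s2 e2] := IH; first by move=> x xr; apply: H; rewrite inE xr orbT.
by exists (s1 ++ s2); rewrite /minor_comb big_cat big_cons e1 e2.
Qed.

(** The Gröbner basis property of the maximal minors, read off from any expression of [p] through
    minors. *)
Lemma initial_minors_divisible (p : {mpoly K[N]}) u :
  minors_ideal p -> initial_monomial (@ladder_lex n m L) p u ->
  exists a, (row_mon L (tnth a) <= u)%MM.
Proof.
move=> /minors_ideal_comb[s ->] [us umax].
have nz : minor_comb s != 0 by apply: contraTneq us => ->; rewrite msupp0.
have [t ts tmax] : exists2 t, t \in s &
    forall t', t' \in s -> ladder_lex (term_lead t') (term_lead t).
  by apply: max_term; apply: contraNneq nz => ->; rewrite /minor_comb big_nil.
pose D := (\max_(t <- s) mdeg (term_lead t))%N.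
have [|v [a [[vs vmax] av]]] := minor_comb_initial (D := D) (M := term_lead t) _ nz.
  by move=> t' t's; split; [exact: tmax|exact: leq_bigmax_seq].
exists a; have -> // : u = v.
by apply: ladder_lex_anti; rewrite vmax // umax.
Qed.

Lemma diagonal_termE a : diagonal_term K L a = 'X_[row_mon L (tnth a)].
Proof. by rewrite /diagonal_term ladder_mx_prod cols_in. Qed.

(** Each generator of the initial ideal is a monomial divisible by some x_a. *)
Lemma initial_minors_ideal_comb (p : {mpoly K[N]}) : initial_minors_ideal p ->
  exists s : seq ({mpoly K[N]} * ladder_cols K L),
    p = \sum_(q <- s) q.1 * diagonal_term K L q.2.
Proof.
move=> [r [rP ->]]; elim: r rP => [_|q r IH rP]; first by exists [::]; rewrite !big_nil.
have [|s e] := IH; first by move=> x xr; apply: rP; rewrite inE xr orbT.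
have [f [u [fI fu qE]]] := rP q (mem_head _ _).
have [a au] := initial_minors_divisible fI fu.
exists ((q.1 * 'X_[u - row_mon L (tnth a)], a) :: s).
by rewrite !big_cons e /= diagonal_termE -mulrA -mpolyXD submK // qE.
Qed.

End Minors.

(** * Straightening in a distributive lattice *)

Section IdealGen.

Variables (R : comNzRingType) (S : R -> Prop).

Lemma ideal_gen0 : ideal_gen S 0.
Proof. by exists [::]; rewrite big_nil. Qed.

Lemma ideal_genD x y : ideal_gen S x -> ideal_gen S y -> ideal_gen S (x + y).
Proof.
move=> [s [sS ->]] [t [tS ->]]; exists (s ++ t); rewrite big_cat; split=> // p.
by rewrite mem_cat => /orP[/sS|/tS].
Qed.

Lemma ideal_genMl a x : ideal_gen S x -> ideal_gen S (a * x).
Proof.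
move=> [s [sS ->]]; exists [seq (a * p.1, p.2) | p <- s]; split.
  by move=> _ /mapP[q /sS qS ->].
by rewrite big_map mulr_sumr; apply: eq_bigr => p _; rewrite mulrA.
Qed.

Lemma ideal_genN x : ideal_gen S x -> ideal_gen S (- x).
Proof. by rewrite -mulN1r; apply: ideal_genMl. Qed.

Lemma ideal_gen_sum (I : eqType) (r : seq I) (F : I -> R) :
  (forall i, i \in r -> ideal_gen S (F i)) -> ideal_gen S (\sum_(i <- r) F i).
Proof.
move=> H; rewrite big_seq; apply: big_ind => //; [exact: ideal_gen0|exact: ideal_genD].
Qed.

End IdealGen.

(** * Chains and normal forms of monomials *)

Section Straightening.

Variables (d : Order.disp_t) (P : finDistrLatticeType d).
Implicit Types (p q x : P) (s c : seq P) (u v w : 'X_{1..#|P|}).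

Local Notation U p := (U_(enum_rank p))%MM.

(** Lists with repetitions represent monomials, so that straightening can recurse on them. *)
Definition seq_mon s : 'X_{1..#|P|} := (\big[+%MM/0%MM]_(p <- s) U p)%MM.

Lemma seq_mon_cons p s : seq_mon (p :: s) = (U p + seq_mon s)%MM.
Proof. by rewrite /seq_mon big_cons. Qed.

Lemma mdeg_seq_mon s : mdeg (seq_mon s) = size s.
Proof. by elim: s => [|p s IH]; rewrite /seq_mon ?big_nil ?mdeg0 // big_cons mdegD mdeg1 IH. Qed.

Lemma seq_mon_rem p s : p \in s -> seq_mon s = (U p + seq_mon (rem p s))%MM.
Proof. by move=> ps; rewrite /seq_mon (big_rem _ ps). Qed.

Lemma seq_monP u : exists s, u = seq_mon s.
Proof.
move e : (mdeg u) => k; elim: k u e => [|k IH] u.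
  by move/eqP; rewrite mdeg_eq0 => /eqP->; exists [::]; rewrite /seq_mon big_nil.
move=> e; have [i ui] : exists i, u i != 0%N.
  apply: contrapT => no; have: u == 0%MM.
    by apply/eqP/mnmP => i; rewrite mnm0E; apply: contrapT => ui; apply: no; exists i; apply/eqP.
  by rewrite -mdeg_eq0 e.
have le : (U_(i) <= u)%MM by rewrite lep1mP.
have [s us] : exists s, (u - U_(i))%MM = seq_mon s.
  by apply: IH; move: e; rewrite -{1}(submK le) mdegD mdeg1 addn1 => -[].
by exists (enum_val i :: s); rewrite seq_mon_cons -us enum_valK addmC submK.
Qed.

Definition chain c := {in c &, forall x y, (x >=< y)%O}.

Lemma chain_top p c : chain (p :: c) ->
  exists2 x, x \in p :: c & {in p :: c, forall y, (y <= x)%O}.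
Proof.
elim: c p => [|q c IH] p ch.
  by exists p; rewrite ?mem_head // => y /[1!inE]/eqP->.
have [|x xc xmax] := IH q; first by move=> y z yc zc; apply: ch; rewrite inE ?yc ?zc orbT.
have xc' : x \in p :: q :: c by rewrite inE xc orbT.
have /orP[px|xp] := ch _ _ (mem_head _ _) xc'.
  by exists x => // y /[1!inE]/orP[/eqP->|/xmax].
exists p; first exact: mem_head.
by move=> y /[1!inE]/orP[/eqP->//|/xmax yx]; apply: le_trans xp.
Qed.

(* [img u] is the toric image of the monomial [u]; [grading_bound] says that it
   determines the upper bounds of the support of [u]. *)
Record hibi_grading (T : Type) (img : 'X_{1..#|P|} -> T) : Prop := HibiGrading {
  gradingD : forall u v w, img u = img v -> img (w + u)%MM = img (w + v)%MM;
  gradingI : forall u v w, img (w + u)%MM = img (w + v)%MM -> img u = img v;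
  grading_mdeg : forall u v, img u = img v -> mdeg u = mdeg v;
  grading_hibi : forall p q,
    img (U p + U q)%MM = img (U (p `&` q)%O + U (p `|` q)%O)%MM;
  grading_bound : forall s s' x, img (seq_mon s) = img (seq_mon s') ->
    {in s', forall q, (q <= x)%O} -> {in s, forall q, (q <= x)%O} }.

Variables (T : Type) (img : 'X_{1..#|P|} -> T).
Hypothesis img_ok : hibi_grading img.

(** The tops agree by [grading_bound] in both directions; cancelling them by [gradingI] leaves
    shorter chains. *)
Lemma chain_img_inj c c' : chain c -> chain c' ->
  img (seq_mon c) = img (seq_mon c') -> seq_mon c = seq_mon c'.
Proof.
move: {2}(size c) (erefl (size c)) => k; elim: k c c' => [|k IH] c c'.
  move=> /size0nil-> _ _ /(grading_mdeg img_ok)/esym; rewrite !mdeg_seq_mon => /size0nil-> //.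
case: c => // p c sz chc chc' e.
case: c' chc' e => [_ /(grading_mdeg img_ok)|p' c' chc' e]; first by rewrite !mdeg_seq_mon sz.
have [x xc xmax] := chain_top chc; have [x' xc' xmax'] := chain_top chc'.
have xx' : x = x'.
  apply: le_anti; apply/andP; split.
    exact: (grading_bound img_ok e xmax').
  exact: (grading_bound img_ok (esym e) xmax).
subst x'; move: e; rewrite (seq_mon_rem xc) (seq_mon_rem xc') => /(gradingI img_ok) e.
congr (_ + _)%MM; apply: IH e.
- by rewrite size_rem // sz.
- by move=> y z /mem_rem yc /mem_rem zc; apply: chc.
- by move=> y z /mem_rem yc /mem_rem zc; apply: chc'.
Qed.

Variable E : 'X_{1..#|P|} -> 'X_{1..#|P|} -> Prop.
Hypothesis Erefl : forall u, E u u.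
Hypothesis Etrans : forall u v w, E u v -> E v w -> E u w.
Hypothesis ED : forall u v w, E u v -> E (w + u)%MM (w + v)%MM.
Hypothesis E_hibi : forall p q, E (U p + U q)%MM (U (p `&` q)%O + U (p `|` q)%O)%MM.

(** One bubble pass: at each step the meet is left behind and the join is carried along, so the last
    join dominates the list. *)
Lemma extract_top p s : exists x s',
  [/\ E (seq_mon (p :: s)) (seq_mon (x :: s')),
      img (seq_mon (p :: s)) = img (seq_mon (x :: s')),
      {in p :: s, forall q, (q <= x)%O} & size s' = size s].
Proof.
elim: s p => [|q s IH] p.
  by exists p, [::]; split=> // y /[1!inE]/eqP->.
have [x [s' [Es es xmax szs]]] := IH (p `|` q)%O.
have e1 : seq_mon [:: p, q & s] = (seq_mon s + (U p + U q))%MM.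
  by rewrite !seq_mon_cons addmA addmC.
have e2 : (seq_mon s + (U (p `&` q)%O + U (p `|` q)%O))%MM =
          (U (p `&` q)%O + seq_mon ((p `|` q)%O :: s))%MM.
  by rewrite seq_mon_cons addmC addmA.
have e3 : seq_mon [:: x, (p `&` q)%O & s'] = (U (p `&` q)%O + seq_mon (x :: s'))%MM.
  by rewrite !seq_mon_cons !addmA [(U x + _)%MM]addmC.
have pqx : (p `|` q <= x)%O by apply: xmax; apply: mem_head.
exists x, ((p `&` q)%O :: s'); rewrite e1 e3; split.
- by apply: Etrans (ED _ (E_hibi p q)) _; rewrite e2; apply: ED.
- by rewrite (gradingD img_ok _ (grading_hibi img_ok p q)) e2; apply: (gradingD img_ok).
- move=> y /[1!inE]/orP[/eqP->|/[1!inE]/orP[/eqP->|ys]].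
  + exact: le_trans (leUl _ _) pqx.
  + exact: le_trans (leUr _ _) pqx.
  + by apply: xmax; rewrite inE ys orbT.
- by rewrite /= szs.
Qed.

(* [E] is either congruence modulo the Hibi ideal or descent in a compatible order. *)
Lemma straighten s : exists c,
  [/\ chain c, E (seq_mon s) (seq_mon c) & img (seq_mon s) = img (seq_mon c)].
Proof.
move: {2}(size s) (erefl (size s)) => k; elim: k s => [|k IH] s.
  by move=> /size0nil->; exists [::].
case: s => // p s [szs]; have [x [s' [Es es xmax szs']]] := extract_top p s.
have [|c [chc Ec ec]] := IH s'; first by rewrite szs'.
have exc : img (seq_mon (p :: s)) = img (seq_mon (x :: c)).
  by rewrite es !seq_mon_cons; apply: (gradingD img_ok).
(* Straightening the tail preserves the image, hence also the upper bound [x]. *)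
have cx : {in c, forall q, (q <= x)%O}.
  by move=> q qc; apply: (grading_bound img_ok (esym exc) xmax); rewrite inE qc orbT.
exists (x :: c); split=> //; last first.
  by apply: Etrans Es _; rewrite !seq_mon_cons; apply: ED.
move=> y z /[1!inE]/orP[/eqP->|yc] /[1!inE]/orP[/eqP->|zc].
- exact: comparablexx.
- by rewrite comparable_sym; apply: le_comparable; apply: cx.
- by apply: le_comparable; apply: cx.
- exact: chc.
Qed.

(** The chain reached from [s] has the image of [c], so it gives the same monomial. *)
Lemma straighten_chain c s : chain c -> img (seq_mon s) = img (seq_mon c) ->
  E (seq_mon s) (seq_mon c).
Proof.
move=> chc e; have [c' [chc' Es es]] := straighten s.
by rewrite (chain_img_inj chc chc') // -e.
Qed.

End Straightening.

(** * Hibi relations *)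

Section HibiIdeal.

Variables (K : fieldType) (d : Order.disp_t) (P : finDistrLatticeType d).
Variables (T : eqType) (img : 'X_{1..#|P|} -> T).
Hypothesis img_ok : hibi_grading img.
Implicit Types (p q : P) (u v w : 'X_{1..#|P|}) (f : {mpoly K[#|P|]}).

Local Notation U p := (U_(enum_rank p))%MM.
Local Notation hibi_gen := (fun g => exists a b : P, g = hibi_rel K a b).

Lemma hibi_relE p q :
  hibi_rel K p q = 'X_[U p + U q] - 'X_[U (p `&` q)%O + U (p `|` q)%O].
Proof. by rewrite /hibi_rel !mpolyXD. Qed.

(** The join occurs on the right but is neither [p] nor [q]. *)
Lemma incomparable_mon_neq p q : (p >< q)%O ->
  (U p + U q)%MM != (U (p `&` q)%O + U (p `|` q)%O)%MM.
Proof.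
move=> pq; apply/eqP => /mnmP/(_ (enum_rank (p `|` q)%O)).
rewrite !mnmDE !mnm1E !(inj_eq enum_rank_inj) eqxx.
have -> : (p == p `|` q)%O = false.
  by apply/eqP => e; move: pq; rewrite /Order.comparable [(q <= p)%O]leEjoin joinC -e eqxx orbT.
have -> : (q == p `|` q)%O = false.
  by apply/eqP => e; move: pq; rewrite /Order.comparable [(p <= q)%O]leEjoin -e eqxx.
by case: (_ == _).
Qed.

(** For comparable elements the two monomials coincide; otherwise both lie in the support of the
    Hibi relation and compatibility applies. *)
Lemma compatible_le (le : rel 'X_{1..#|P|}) p q :
    monomial_order le -> hibi_compatible K P le ->
  le (U (p `&` q)%O + U (p `|` q)%O)%MM (U p + U q)%MM.
Proof.
move=> [lexx _ _ _ _] comp; have [pq|pq] := boolP (p >=< q)%O.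
  case/orP: pq => [pq|qp]; first by rewrite (meet_l pq) (join_r pq).
  by rewrite (meet_r qp) (join_l qp) addmC.
have [_] := comp p q pq; apply; rewrite hibi_relE mcoeff_msupp mcoeffB !mcoeffX eqxx.
by rewrite (negPf (incomparable_mon_neq pq)) sub0r oppr_eq0 oner_neq0.
Qed.

(** A monomial without incomparable factors is a chain monomial, and every monomial of its fiber
    descends to it by straightening. *)
Lemma standard_mon_min (le : rel 'X_{1..#|P|}) u v :
    monomial_order le -> hibi_compatible K P le ->
    (forall p q, (p >< q)%O -> ~~ (U p + U q <= u)%MM) ->
  img v = img u -> le u v.
Proof.
move=> lemon comp; have [lexx _ letr _ [_ leD]] := lemon.
have [c ->] := seq_monP u; have [s ->] := seq_monP v => std e.
apply: (straighten_chain img_ok (E := fun v u => le u v)) e => //.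
- by move=> x y z yx zy; apply: letr zy yx.
- by move=> x y z; rewrite ![(z + _)%MM]addmC; apply: leD.
- by move=> p q; apply: compatible_le.
move=> p q pc qc; apply: contrapT => /negP/[dup] pq /std/negP; apply.
(* Incomparable elements are distinct, so [q] survives the removal of [p]. *)
have qc' : q \in rem p c.
  by apply: rem_mem => //; apply: contraNneq pq => ->; rewrite comparablexx.
by rewrite (seq_mon_rem pc) (seq_mon_rem qc') addmA lem_addr.
Qed.

(** Both monomials are congruent to the chain monomial of their common image. *)
Lemma hibi_congr u v : img u = img v -> ideal_gen hibi_gen ('X_[u] - 'X_[v]).
Proof.
pose E u v := ideal_gen hibi_gen ('X_[u] - 'X_[v]).
have Erefl x : E x x by rewrite /E subrr; apply: ideal_gen0.
have Etrans x y z : E x y -> E y z -> E x z.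
  move=> xy yz; rewrite /E -[X in X - _](subrK 'X_[y]) -addrA; exact: ideal_genD.
have Esym x y : E x y -> E y x by rewrite /E -[X in _ -> _ X]opprB; apply: ideal_genN.
have ED x y z : E x y -> E (z + x)%MM (z + y)%MM.
  by rewrite /E !mpolyXD -mulrBr; apply: ideal_genMl.
have Eh p q : E (U p + U q)%MM (U (p `&` q)%O + U (p `|` q)%O)%MM.
  by rewrite /E -hibi_relE; apply: ideal_gen_in; exists p, q.
have [s ->] := seq_monP u; have [t ->] := seq_monP v => e.
have [c [chc sc ec]] := straighten img_ok Erefl Etrans ED Eh s.
apply: (Etrans _ _ _ sc); apply: (Esym _ _).
by apply: (straighten_chain img_ok Erefl Etrans ED Eh chc); rewrite -e -ec.
Qed.

(** Modulo the Hibi ideal each monomial is replaced by a representative of its fiber, the first one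
    in the support of [f]. The coefficients of the result are the fiber sums. *)
Lemma hibi_ideal_grading f :
    (forall t : T, \sum_(v <- msupp f | img v == t) f@_v = 0) ->
  ideal_gen hibi_gen f.
Proof.
move=> f0; pose rep v := nth 0%MM (msupp f) (find (fun w => img w == img v) (msupp f)).
have repP v : v \in msupp f -> img (rep v) = img v.
  move=> vf; apply/eqP; apply: (nth_find 0%MM (a := fun w => img w == img v)).
  by apply/hasP; exists v.
have rep_eq v w : img v = img w -> rep v = rep w by rewrite /rep => ->.
have -> : f = \sum_(v <- msupp f) f@_v *: ('X_[v] - 'X_[rep v])
            + \sum_(v <- msupp f) f@_v *: 'X_[rep v].
  by rewrite -big_split {1}[f]mpolyE; apply: eq_bigr => v _ /=; rewrite -scalerDr subrK.
rewrite [X in _ + X](_ : _ = 0) ?addr0.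
  apply: ideal_gen_sum => v vf; rewrite -mul_mpolyC; apply: ideal_genMl.
  by apply: hibi_congr; rewrite repP.
apply/mpolyP => x; rewrite mcoeff0 raddf_sum /=.
under eq_bigr => v _ do rewrite mcoeffZ mcoeffX.
(* At a representative the coefficient is a full fiber sum; elsewhere every summand is zero. *)
have [/hasP[v0 v0f /eqP v0x]|/hasPn no] := boolP (has (fun v => rep v == x) (msupp f)).
  rewrite -[RHS](f0 (img v0)) [RHS]big_mkcond; apply: eq_big_seq => v vf.
  have -> : (rep v == x) = (img v == img v0).
    apply/eqP/eqP => [|/rep_eq->//]; rewrite -v0x => /(congr1 img).
    by rewrite !repP.
  by case: eqP; rewrite ?mulr1 ?mulr0.
by apply: big1_seq => v /andP[_ /no/negPf->]; rewrite mulr0.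
Qed.

End HibiIdeal.

(** * Quotients and fiber rings *)

Section QuotientIso.

Variables (A B : comNzRingType) (I : idealr A) (phi : {rmorphism A -> B}).
Hypothesis kerI : forall x, phi x = 0 -> x \in I.
Hypothesis Iker : forall x, x \in I -> phi x = 0.
Hypothesis phi_surj : forall y, exists x, phi x = y.

(** First isomorphism theorem, directed from [B] to the quotient to match [algebra_iso] with the
    special fiber as source. Preimages are chosen by a section, and the choice is immaterial modulo
    [I]. *)
Lemma quotient_iso : exists g : {rmorphism B -> {ideal_quot I}},
  bijective g /\ forall x, g (phi x) = (\pi_({ideal_quot I}) x)%qT.
Proof.
have [s sK] := choice phi_surj.
pose g y := (\pi_({ideal_quot I}) (s y))%qT.
have pi_eq x y : phi x = phi y -> (\pi_({ideal_quot I}) x = \pi_({ideal_quot I}) y)%qT.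
  by move=> e; apply/eqP; rewrite -Quotient.idealrBE; apply: kerI; rewrite rmorphB e subrr.
have eq_pi x y : (\pi_({ideal_quot I}) x = \pi_({ideal_quot I}) y)%qT -> phi x = phi y.
  by move/eqP; rewrite -Quotient.idealrBE => /Iker/eqP; rewrite rmorphB subr_eq0 => /eqP.
have gB : zmod_morphism g.
  by move=> x y; rewrite /g -rmorphB; apply: pi_eq; rewrite rmorphB !sK.
have gM : monoid_morphism g.
  split; first by rewrite /g -(rmorph1 (\pi_({ideal_quot I}))%qT); apply: pi_eq; rewrite sK rmorph1.
  by move=> x y; rewrite /g -rmorphM; apply: pi_eq; rewrite rmorphM !sK.
pose ga := GRing.isZmodMorphism.Build _ _ g gB.
pose gm := GRing.isMonoidMorphism.Build _ _ g gM.
pose gR : {rmorphism B -> {ideal_quot I}} := HB.pack g ga gm.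
exists gR; split; last by move=> x; apply: pi_eq; rewrite sK.
exists (fun x => phi (generic_quotient.repr x)) => [y|x]; rewrite /= /g.
  by rewrite -[RHS]sK; apply: eq_pi; rewrite reprK.
by rewrite -[RHS]reprK; apply: pi_eq; rewrite sK.
Qed.

End QuotientIso.

(** * Coefficients of products and evaluation at the origin *)

Section MpolyCoef.

Variable (R : comNzRingType).

Lemma mcoeffM_neq0 N (p q : {mpoly R[N]}) u : (p * q)@_u != 0 ->
  exists u1 u2, [/\ u = (u1 + u2)%MM, p@_u1 != 0 & q@_u2 != 0].
Proof.
move=> nz; apply: contrapT => no; case/eqP: nz; rewrite mcoeffM big1 // => -[u1 u2] /= /eqP e.
have [->|p0] := eqVneq p@_u1 0; first by rewrite mul0r.
have [->|q0] := eqVneq q@_u2 0; first by rewrite mulr0.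
by case: no; exists u1, u2.
Qed.

Lemma mcoeffM2_neq0 N M (p q : {mpoly {mpoly R[N]}[M]}) b a : ((p * q)@_b)@_a != 0 ->
  exists b1 b2 a1 a2, [/\ b = (b1 + b2)%MM, a = (a1 + a2)%MM,
    (p@_b1)@_a1 != 0 & (q@_b2)@_a2 != 0].
Proof.
move=> nz; apply: contrapT => no; case/eqP: nz; rewrite mcoeffM raddf_sum big1 //=.
move=> -[b1 b2] /= /eqP e; apply/eqP; apply: contrapT => /negP/mcoeffM_neq0[a1 [a2 [ea p0 q0]]].
by case: no; exists b1, b2, a1, a2.
Qed.

(** Every monomial other than 1 has a variable as a factor, so [g] kills it. *)
Lemma mpoly_rmorph_eval0 N (S : comNzRingType) (g : {rmorphism {mpoly R[N]} -> S}) :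
  (forall v, g 'X_v = 0) -> forall p, g p = g (p@_0%MM)%:MP.
Proof.
move=> gX p.
have gXu u : u != 0%MM -> g 'X_[u] = 0.
  rewrite -mdeg_eq0 mdegE sum_nat_eq0 negb_forall => /existsP[v]; rewrite /= => uv.
  have le : (U_(v) <= u)%MM by rewrite lep1mP.
  by rewrite -(submK le) mpolyXD rmorphM gX mulr0.
rewrite {1}[p]mpolyE rmorph_sum.
have [i0|n0] := boolP (0%MM \in msupp p); last first.
  rewrite (memN_msupp_eq0 n0) mpolyC0 rmorph0; apply: big1_seq => u /andP[_ up].
  by rewrite -mul_mpolyC rmorphM gXu ?mulr0 //; apply: contraNneq n0 => <-.
rewrite (bigD1_seq 0%MM) ?msupp_uniq //= mpolyX0 -mul_mpolyC mulr1 big1 ?addr0 // => u u0.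
by rewrite -mul_mpolyC rmorphM gXu ?mulr0.
Qed.

End MpolyCoef.

(** * Structure maps of the Rees algebra and the special fiber *)

Section FiberMorphisms.

Variables (K : fieldType) (N r : nat) (I : 'I_r -> {mpoly K[N]} -> Prop).

Lemma rees_const_zmod : zmod_morphism (@rees_const K N r I).
Proof. by move=> x y; apply: val_inj; rewrite /= mpolyCB. Qed.

Lemma rees_const_monoid : monoid_morphism (@rees_const K N r I).
Proof. by split=> [|x y]; apply: val_inj; rewrite /= ?mpolyC1 ?mpolyCM. Qed.

HB.instance Definition _ := GRing.isZmodMorphism.Build _ _ (@rees_const K N r I) rees_const_zmod.
HB.instance Definition _ := GRing.isMonoidMorphism.Build _ _ (@rees_const K N r I) rees_const_monoid.

Lemma fiber_class_zmod : zmod_morphism (@fiber_class K N r I).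
Proof. by move=> x y; rewrite /fiber_class -rmorphB. Qed.

Lemma fiber_class_monoid : monoid_morphism (@fiber_class K N r I).
Proof. by split=> [|x y]; rewrite /fiber_class ?rmorph1 ?rmorphM. Qed.

HB.instance Definition _ := GRing.isZmodMorphism.Build _ _ (@fiber_class K N r I) fiber_class_zmod.
HB.instance Definition _ := GRing.isMonoidMorphism.Build _ _ (@fiber_class K N r I) fiber_class_monoid.

Lemma fiber_class_eq0 y : (fiber_class y == 0 :> special_fiber I) = (y \in @fiber_ideal K N r I).
Proof. by rewrite -[in RHS](subr0 y) Quotient.idealrBE /fiber_class rmorph0. Qed.

Lemma fiber_class_surj (z : special_fiber I) : exists y, fiber_class y = z.
Proof. by exists (generic_quotient.repr z); rewrite /fiber_class reprK. Qed.

Lemma fiber_class_const p :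
  fiber_class (@rees_const K N r I p) = fiber_class (rees_const I (p@_0%MM)%:MP).
Proof.
apply: (mpoly_rmorph_eval0 (g := @fiber_class K N r I \o @rees_const K N r I)) => v /=.
apply/eqP; rewrite fiber_class_eq0; apply/asboolP/ideal_gen_in; by exists v.
Qed.

End FiberMorphisms.

(** * The toric map of a ladder *)

Section LadderFiber.

Variables (n m r : nat) (K : fieldType) (L : ladder n m).
Local Notation N := #|{: ladder_entry L}|.
Local Notation P := (ladder_index r K L).
Local Notation I := (@initial_family n m r K L).
Implicit Types (p q : P) (s : seq P) (u v w : 'X_{1..#|P|}).

Lemma ladder_index_le p q : (p <= q)%O <->
  (forall i, (tnth p.1 i <= tnth q.1 i)%N) /\ (p.2 <= q.2)%N.
Proof.
rewrite leEprod; split=> [/andP[le1 le2]|[le1 le2]].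
  split=> [i|]; last by move: le2; rewrite leEord.
  have : (val p.1 <= val q.1)%O by [].
  by rewrite Order.TupleProdOrder.leEtprod => /forallP/(_ i).
apply/andP; split; last by rewrite leEord.
suff: (val p.1 <= val q.1)%O by [].
by rewrite Order.TupleProdOrder.leEtprod; apply/forallP.
Qed.

(** [xdeg u] and [tdeg u] are the exponents in x and t of the image of T^u under T_{a,i} |-> x_a
    t_i. *)
Definition xdeg u : 'X_{1..N} := (\sum_k row_mon L (tnth (enum_val k : P).1) *+ u k)%MM.

Definition tdeg u : 'X_{1..r} := (\sum_k U_((enum_val k : P).2) *+ u k)%MM.

Definition bideg u := (xdeg u, tdeg u).

Let sum_mulmD (k : nat) (F : 'I_#|P| -> 'X_{1..k}) u v :
  (\sum_i F i *+ (u + v)%MM i = \sum_i F i *+ u i + \sum_i F i *+ v i)%MM.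
Proof.
rewrite -big_split; apply: eq_bigr => i _ /=; rewrite mnmDE.
by apply/mnmP => j; rewrite mnmDE !mulmnE mulnDr.
Qed.

Let sum_mulm1 (k : nat) (F : 'I_#|P| -> 'X_{1..k}) j :
  (\sum_i F i *+ U_(j)%MM i = F j)%MM.
Proof.
rewrite (bigD1 j) //= big1 => [|i ij]; rewrite mnm1E.
  by rewrite eqxx mulm1n addm0.
by rewrite eq_sym (negPf ij) mulm0n.
Qed.

Lemma xdegD u v : xdeg (u + v)%MM = (xdeg u + xdeg v)%MM.
Proof. exact: sum_mulmD. Qed.

Lemma tdegD u v : tdeg (u + v)%MM = (tdeg u + tdeg v)%MM.
Proof. exact: sum_mulmD. Qed.

Lemma xdeg1 p : xdeg U_(enum_rank p)%MM = row_mon L (tnth p.1).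
Proof. by rewrite /xdeg sum_mulm1 enum_rankK. Qed.

Lemma tdeg1 p : tdeg U_(enum_rank p)%MM = U_(p.2)%MM.
Proof. by rewrite /tdeg sum_mulm1 enum_rankK. Qed.

Lemma mdeg_tdeg u : mdeg (tdeg u) = mdeg u.
Proof.
rewrite /tdeg mdeg_sum [RHS]mdegE; apply: eq_bigr => i _.
by rewrite mdegMn mdeg1 mul1n.
Qed.

Lemma mdeg_xdeg u : mdeg (xdeg u) = (n * mdeg u)%N.
Proof.
rewrite /xdeg mdeg_sum [in RHS]mdegE big_distrr; apply: eq_bigr => i _ /=.
by rewrite mdegMn mdeg_row_mon // cols_in.
Qed.

Lemma bideg_mdeg u v : bideg u = bideg v -> mdeg u = mdeg v.
Proof. by case=> _ e; rewrite -mdeg_tdeg e mdeg_tdeg. Qed.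

(** The columns used by [s] in each row are visible in the toric image. With [tdeg_gt0] for the
    chain factor, this gives [grading_bound]. *)
Lemma entry_exp_xdeg s i j : (i, j) \in (L : {set _}) ->
  (0 < entry_exp (xdeg (seq_mon s)) (i, j))%N = has (fun p : P => tnth p.1 i == j) s.
Proof.
move=> ijL; elim: s => [|p s IH].
  rewrite /seq_mon big_nil /xdeg big1 => [|k _]; last by rewrite mnm0E mulm0n.
  by rewrite /entry_exp; case: insub => //= v; rewrite mnm0E.
rewrite seq_mon_cons xdegD entry_expD addn_gt0 IH xdeg1 entry_exp_row ?cols_in //=.
by case: eqP.
Qed.

Lemma tdeg_gt0 s j : (0 < tdeg (seq_mon s) j)%N = has (fun p : P => p.2 == j) s.
Proof.
elim: s => [|p s IH].
  by rewrite /seq_mon big_nil /tdeg big1 ?mnm0E // => k _; rewrite mnm0E mulm0n.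
by rewrite seq_mon_cons tdegD mnmDE addn_gt0 IH tdeg1 mnm1E /=; case: eqP.
Qed.

Lemma row_mon_meet_join (a b : ladder_cols K L) :
  (row_mon L (tnth a) + row_mon L (tnth b) =
   row_mon L (tnth (a `&` b)%O) + row_mon L (tnth (a `|` b)%O))%MM.
Proof.
rewrite /row_mon -!big_split; apply: eq_bigr => i _ /=.
have -> : tnth (a `&` b)%O i = Order.min (tnth a i) (tnth b i).
  transitivity (tnth (val a `&` val b)%O i) => //.
  by rewrite Order.TupleProdOrder.tnth_meet meetEtotal.
have -> : tnth (a `|` b)%O i = Order.max (tnth a i) (tnth b i).
  transitivity (tnth (val a `|` val b)%O i) => //.
  by rewrite Order.TupleProdOrder.tnth_join joinEtotal.
by case: leP => // _; rewrite addmC.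
Qed.

Lemma ladder_hibi_grading : hibi_grading bideg.
Proof.
split.
- by move=> u v w [ex et]; rewrite /bideg !xdegD !tdegD ex et.
- by move=> u v w []; rewrite !xdegD !tdegD => /addmI ex /addmI et; rewrite /bideg ex et.
- exact: bideg_mdeg.
- move=> p q; rewrite /bideg !xdegD !tdegD !xdeg1 !tdeg1; congr (_, _).
    exact: row_mon_meet_join.
  rewrite [(p `&` q)%O.2](_ : _ = Order.min p.2 q.2); last by rewrite -meetEtotal.
  rewrite [(p `|` q)%O.2](_ : _ = Order.max p.2 q.2); last by rewrite -joinEtotal.
  by case: leP => // _; rewrite addmC.
(* Each coordinate of [p] is also that of some element of [s'], possibly a different one for each
   coordinate, and is therefore bounded by [x]. *)
- move=> s s' x [ex et] s'x p ps; apply/ladder_index_le; split=> [i|].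
    have pL := forallP (cols_in p.1) i.
    have : (0 < entry_exp (xdeg (seq_mon s)) (i, tnth p.1 i))%N.
      by rewrite entry_exp_xdeg //; apply/hasP; exists p.
    rewrite ex entry_exp_xdeg // => /hasP[q /s'x/ladder_index_le[le _] /eqP <-].
    exact: le.
  have : (0 < tdeg (seq_mon s) p.2)%N by rewrite tdeg_gt0; apply/hasP; exists p.
  by rewrite et tdeg_gt0 => /hasP[q /s'x/ladder_index_le[_ le] /eqP <-].
Qed.

Definition toric_gen (k : 'I_#|P|) : {mpoly {mpoly K[N]}[r]} :=
  ('X_[row_mon L (tnth (enum_val k : P).1)])%:MP * 'X_((enum_val k : P).2).

Lemma toric_mon u : mmap1 toric_gen u = ('X_[xdeg u])%:MP * 'X_[tdeg u].
Proof.
rewrite /mmap1 /toric_gen; under eq_bigr => k _ do rewrite exprMn -rmorphXn /= !mpolyXn.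
by rewrite big_split /= -rmorph_prod /= !mprodXE.
Qed.

(** The toric map, written as the sum to which [mmap] unfolds, for direct access to coefficients. *)
Definition toric (f : {mpoly K[#|P|]}) : {mpoly {mpoly K[N]}[r]} :=
  \sum_(u <- msupp f) (f@_u)%:MP%:MP * mmap1 toric_gen u.

(** This identifies the toric kernel with the fiber-sum condition of [hibi_ideal_grading]. *)
Lemma toric_coef f b a : ((toric f)@_b)@_a =
  \sum_(u <- msupp f | bideg u == (a, b)) f@_u.
Proof.
rewrite /toric !raddf_sum [RHS]big_mkcond /=; apply: eq_bigr => u _.
rewrite toric_mon mulrA -rmorphM mcoeffCM mcoeffX /bideg xpair_eqE andbC.
case: eqP => _ /=; last by rewrite mulr0 mcoeff0.
by rewrite mulr1 mcoeffCM mcoeffX; case: eqP => _; rewrite ?mulr1 ?mulr0.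
Qed.

Definition rees_gen (k : 'I_#|P|) : rees_algebra I :=
  @rees_elt K _ r I (enum_val k : P).2 _ (diagonal_term_cols (enum_val k : P).1).

(** The presentation map factors through the Rees algebra, where its lift takes the value
    [toric f]. *)
Lemma presentation_idealE f : presentation_ideal r K L f <->
  exists2 y : rees_algebra I, y \in @fiber_ideal K N r I & val y = toric f.
Proof.
rewrite /presentation_ideal.
pose y := \sum_(u <- msupp f) rees_const I (f@_u)%:MP * mmap1 rees_gen u.
have -> : mmap (initial_fiber_scalar r K L) (fun k => fiber_gen (enum_val k)) f = fiber_class y.
  rewrite rmorph_sum; apply: eq_bigr => u _; rewrite rmorphM; congr (_ * _).
  by rewrite rmorph_prod; apply: eq_bigr => k _; rewrite rmorphXn.
have yf : val y = toric f.
  rewrite /y /toric rmorph_sum; apply: eq_bigr => u _; rewrite rmorphM; congr (_ * _).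
  rewrite rmorph_prod.
  apply: eq_bigr => k _.
  have gk : val (rees_gen k) = toric_gen k by rewrite /= /toric_gen diagonal_termE.
  rewrite -gk.
  by rewrite rmorphXn.
split=> [/eqP|[z zI]]; first by rewrite fiber_class_eq0; exists y.
by rewrite -yf => /val_inj <-; apply/eqP; rewrite fiber_class_eq0.
Qed.

(** A multiplicative filtration by the excess of x-degree over n times t-degree. The Rees algebra
    lies in level 0 and the fiber ideal in level 1, while toric monomials have excess exactly 0. *)
Definition tdeg_bound k (z : {mpoly {mpoly K[N]}[r]}) :=
  forall b a, (z@_b)@_a != 0 -> (n * mdeg b + k <= mdeg a)%N.

Lemma tdeg_boundB k y z : tdeg_bound k y -> tdeg_bound k z -> tdeg_bound k (y - z).
Proof.
move=> hy hz b a; rewrite !mcoeffB => nz.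
have [y0|/hy//] := eqVneq (y@_b)@_a 0; apply: hz; apply: contraNneq nz => z0.
by rewrite y0 z0 subrr.
Qed.

Lemma tdeg_boundM k l y z : tdeg_bound k y -> tdeg_bound l z -> tdeg_bound (k + l) (y * z).
Proof.
move=> hy hz b a /mcoeffM2_neq0[b1 [b2 [a1 [a2 [-> -> /hy h1 /hz h2]]]]].
by rewrite !mdegD mulnDr addnACA leq_add.
Qed.

Lemma tdeg_boundC k (c : {mpoly K[N]}) : (forall a, c@_a != 0 -> (k <= mdeg a)%N) ->
  tdeg_bound k c%:MP.
Proof.
move=> ck b a; rewrite mcoeffC; have [->|_] := eqVneq b 0%MM.
  by rewrite mulr1 mdeg0 muln0 => /ck.
by rewrite mulr0 mcoeff0 eqxx.
Qed.

Lemma initial_mdeg (f : {mpoly K[N]}) a : initial_minors_ideal f -> f@_a != 0 -> (n <= mdeg a)%N.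
Proof.
move=> /(@initial_minors_ideal_comb n m K L)[s ->]; apply: contraR => lt.
rewrite raddf_sum big1 //= => q _; rewrite diagonal_termE; apply/eqP.
apply: contraNT lt => /mcoeffM_neq0[a1 [a2 [-> _]]].
rewrite mcoeffX; have [<- _|_] := eqVneq (row_mon L (tnth q.2)) a2; last by rewrite eqxx.
by rewrite mdegD mdeg_row_mon ?cols_in // leq_addl.
Qed.

Lemma rees_tdeg_bound z : z \in @rees_pred K N r I -> tdeg_bound 0 z.
Proof.
move=> /asboolP; elim=> [|y [[c ->]|[i [f [fI ->]]]]|x y _ hx _ hy|x y _ hx _ hy].
- by rewrite -mpolyC1; apply: tdeg_boundC.
- exact: tdeg_boundC.
(* For a generator f t_i, the degree n contributed by [f] compensates the one factor t_i. *)
- move=> b a /mcoeffM2_neq0[b1 [b2 [a1 [a2 [-> ->]]]]].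
  rewrite mcoeffC mcoeffX; have [->|_] := eqVneq b1 0%MM; last by rewrite mulr0 mcoeff0 eqxx.
  rewrite mulr1 => /(initial_mdeg fI) na.
  have [<- _|_] := eqVneq U_(i)%MM b2; last by rewrite mcoeff0 eqxx.
  by rewrite add0m mdeg1 muln1 addn0 mdegD (leq_trans na) // leq_addr.
- exact: tdeg_boundB.
- exact: (@tdeg_boundM 0 0).
Qed.

Lemma fiber_ideal_tdeg_bound (y : rees_algebra I) :
  y \in @fiber_ideal K N r I -> tdeg_bound 1 (val y).
Proof.
move=> /asboolP[s [sI ->]]; rewrite rmorph_sum big_seq; apply: big_ind.
- by move=> b a; rewrite !mcoeff0 eqxx.
- move=> x z hx hz; rewrite -[z]opprK; apply: tdeg_boundB => //.
  by move=> b a; rewrite !mcoeffN oppr_eq0; apply: hz.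
- move=> q /sI[v qv]; rewrite rmorphM; apply: (@tdeg_boundM 0 1).
    by apply: rees_tdeg_bound; case: (q.1).
  rewrite qv; apply: tdeg_boundC => a; rewrite mcoeffX; have [<- _|_] := eqVneq U_(v)%MM a.
    by rewrite mdeg1.
  by rewrite eqxx.
Qed.

Lemma presentation_ideal_toric f : presentation_ideal r K L f <-> toric f = 0.
Proof.
split=> [/presentation_idealE[y yI yf]|f0]; last first.
  by apply/presentation_idealE; exists 0; [apply: rpred0|rewrite f0].
apply/mpolyP => b; apply/mpolyP => a; rewrite !mcoeff0; apply/eqP.
apply: contrapT => /negP nz; have := fiber_ideal_tdeg_bound yI; rewrite yf => /(_ b a nz).
move: nz; rewrite toric_coef => nz.
(* A nonzero coefficient comes from some [u] of this bidegree, whose excess 0 contradicts the bound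
   1. *)
have [/hasP[u _ /eqP[<- <-]]|/hasPn no] := boolP (has (fun u => bideg u == (a, b)) (msupp f)).
  by rewrite mdeg_xdeg mdeg_tdeg addn1 ltnn.
case/eqP: nz; rewrite big_seq_cond big1 // => u /andP[/no/negPf->] //.
Qed.

End LadderFiber.

(** * The special fiber ring *)

Section Main.

Variables (n m r : nat) (K : fieldType) (L : ladder n m).
Local Notation N := #|{: ladder_entry L}|.
Local Notation P := (ladder_index r K L).
Local Notation I := (@initial_family n m r K L).
Local Notation U p := (U_(enum_rank p))%MM.

Lemma toric_hibi (p q : P) : toric (hibi_rel K p q) = 0.
Proof.
pose c : {rmorphism K -> {mpoly {mpoly K[N]}[r]}} := @mpolyC r {mpoly K[N]} \o @mpolyC N K.
have -> : toric (hibi_rel K p q) = mmap c (@toric_gen n m r K L) (hibi_rel K p q) by [].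
have [ex et] : bideg (U p + U q)%MM = bideg (U (p `&` q)%O + U (p `|` q)%O)%MM.
  exact: grading_hibi (ladder_hibi_grading r K L) p q.
by rewrite hibi_relE rmorphB /= !mmapX !toric_mon ex et subrr.
Qed.

Lemma presentation_hibi_ideal f :
  presentation_ideal r K L f <-> f \in @hibi_ideal K _ P.
Proof.
split=> [/presentation_ideal_toric f0|/asboolP fH]; last first.
  apply/presentation_ideal_toric.
  pose c : {rmorphism K -> {mpoly {mpoly K[N]}[r]}} := @mpolyC r {mpoly K[N]} \o @mpolyC N K.
  apply: (ideal_gen_rmorph0 (f := mmap c (@toric_gen n m r K L)) _ fH) => _ [p [q ->]].
  exact: toric_hibi.
apply/asboolP; apply: (hibi_ideal_grading (ladder_hibi_grading r K L)) => -[a b].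
by rewrite -toric_coef f0 !mcoeff0.
Qed.

(** Let u be the initial monomial of g in the toric kernel. If no incomparable pair divided u, it
    would be both smallest in its fiber and largest in g, so its fiber sum would be its own nonzero
    coefficient. *)
Lemma hibi_groebner (le : rel 'X_{1..#|P|}) :
  monomial_order le -> hibi_compatible K P le ->
  groebner_basis le (nontrivial_hibi K P) (presentation_ideal r K L).
Proof.
move=> lemon comp; have [_ leanti _ _ _] := lemon.
have GI g : nontrivial_hibi K P g -> presentation_ideal r K L g.
  by move=> [p [q [_ ->]]]; apply/presentation_ideal_toric/toric_hibi.
split=> // f; split=> [] [s [sS ->]]; last first.
  exists s; split=> // x /sS[g [u [Gg gu e]]]; exists g, u; split=> //; exact: GI.
apply: ideal_gen_sum => x /sS[g [u [/presentation_ideal_toric g0 [ug umax] ->]]].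
apply: ideal_genMl.
have [p [q [pq le_pq]]] : exists p q : P, (p >< q)%O /\ (U p + U q <= u)%MM.
  apply: contrapT => std; have := toric_coef g (tdeg u) (xdeg u).
  rewrite g0 !mcoeff0 big_mkcond (bigD1_seq u) ?msupp_uniq //= eqxx => /esym/eqP.
  rewrite big_seq_cond big1 ?addr0 => [|v /andP[vg nvu]].
    by move: ug; rewrite mcoeff_msupp => /negPf->.
  case: eqP => // vu; case/eqP: nvu; apply: leanti; rewrite (umax _ vg) /=.
  apply: (standard_mon_min (ladder_hibi_grading r K L) lemon comp) vu => p q pq.
  by apply/negP => le_pq; apply: std; exists p, q.
rewrite -(submK le_pq) mpolyXD; apply/ideal_genMl/ideal_gen_in.
exists (hibi_rel K p q), (U p + U q)%MM; split=> //; first by exists p, q.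
exact: comp.
Qed.

Definition fiber_scalar_morph : {rmorphism K -> special_fiber I} :=
  (@fiber_class K N r I \o @rees_const K N r I) \o @mpolyC N K.

Definition presentation_morph : {rmorphism {mpoly K[#|P|]} -> special_fiber I} :=
  mmap fiber_scalar_morph (fun k => fiber_gen (enum_val k : P)).

(** [g] is a polynomial combination of diagonal terms; in the special fiber its coefficients reduce
    to their constant terms. *)
Lemma presentation_morph_rees_elt (i : 'I_r) (g : {mpoly K[N]}) (Ig : I i g) :
  exists f, presentation_morph f = fiber_class (rees_elt Ig).
Proof.
have [s gE] := initial_minors_ideal_comb Ig.
have -> : rees_elt Ig = \sum_(q <- s) rees_const I q.1 *
    @rees_elt K _ r I i _ (diagonal_term_cols q.2).
  apply: val_inj; rewrite rmorph_sum /= {1}gE rmorph_sum mulr_suml.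
  by apply: eq_bigr => q _; rewrite /= mpolyCM mulrA.
exists (\sum_(q <- s) (q.1@_0%MM)%:MP * 'X_(enum_rank ((q.2, i) : P))).
rewrite !rmorph_sum; apply: eq_bigr => q _; rewrite [LHS]rmorphM [RHS]rmorphM.
rewrite /= fiber_class_const mmapC mmapX mmap1U /=.
by rewrite /fiber_gen enum_rankK.
Qed.

Lemma presentation_morph_surj z : exists f, presentation_morph f = z.
Proof.
have [y <-] := fiber_class_surj z.
have /asboolP yP : val y \in @rees_pred K N r I by case: y.
(* [subring_gen] lives in the ambient ring, so the induction runs over underlying values, which are
   lifted back to the Rees algebra at each step. *)
move: yP; move ex: (val y) => x xP; elim: xP y ex => {x z}.
- by move=> y y1; exists 1; rewrite rmorph1 (_ : y = 1) ?rmorph1 //; apply: val_inj.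
- move=> _ [[c ->]|[i [g [Ig ->]]]] y ye.
    exists (c@_0%MM)%:MP; have -> : y = rees_const I c by apply: val_inj.
    by rewrite fiber_class_const /presentation_morph /= mmapC.
  have -> : y = rees_elt Ig by apply: val_inj.
  exact: presentation_morph_rees_elt.
- move=> a b aP IHa bP IHb y ye.
  have aR : a \in @rees_pred K N r I by apply/asboolP.
  have bR : b \in @rees_pred K N r I by apply/asboolP.
  have [f fa] := IHa (Rees aR) erefl; have [g gb] := IHb (Rees bR) erefl.
  exists (f - g); rewrite rmorphB fa gb -rmorphB; congr fiber_class; exact: val_inj.
- move=> a b aP IHa bP IHb y ye.
  have aR : a \in @rees_pred K N r I by apply/asboolP.
  have bR : b \in @rees_pred K N r I by apply/asboolP.
  have [f fa] := IHa (Rees aR) erefl; have [g gb] := IHb (Rees bR) erefl.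
  exists (f * g); rewrite rmorphM fa gb -rmorphM; congr fiber_class; exact: val_inj.
Qed.

Lemma initial_fiber_hibi : (0 < #|P|)%N -> is_hibi_ring (initial_fiber_scalar r K L).
Proof.
move=> P0; exists _, P; split=> //.
have [f f0|f fI|z|g [gbij gE]] := @quotient_iso _ _ (@hibi_ideal K _ P) presentation_morph.
- exact/presentation_hibi_ideal.
- exact/presentation_hibi_ideal.
- exact: presentation_morph_surj.
exists g; split=> // c; rewrite /hibi_scalar -gE; congr (g _).
by rewrite /presentation_morph /= mmapC.
Qed.

End Main.

Theorem theorem4p8 (n m r : nat) (K : fieldType) (L : ladder n m)
    (n_gt0 : (1 <= n)%N) (le_nm : (n <= m)%N) (r_gt0 : (1 <= r)%N)
    (cols_neq0 : (0 < #|{: ladder_cols K L}|)%N) :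
  (forall le : rel 'X_{1..#|ladder_index r K L|},
     monomial_order le -> hibi_compatible K (ladder_index r K L) le ->
     groebner_basis le (nontrivial_hibi K (ladder_index r K L))
                       (presentation_ideal r K L)) /\
  is_hibi_ring (initial_fiber_scalar r K L).
Proof.
split; first exact: hibi_groebner.
apply: initial_fiber_hibi; rewrite card_prod card_ord muln_gt0; exact/andP.
Qed.
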